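(* Let $H>0$, $\alpha>1$, $T\in\mathbb{N}$, let ${\bf W}=\{0,1,2,\ldots\}$, and let $\{X(\alpha^n), n\in{\bf W}\}$ be a zero-mean discrete time scale invariant (DT-SI) process with index $H$ and scale $l=\alpha^T$. Let $Y(n)=\alpha^{-nH}X(\alpha^n)$, $n\in{\bf W}$, be its discrete time periodically correlated counterpart, with spectral densities $f_k$ and spectral density matrix $f(\omega)=[f_{jk}(\omega)]_{j,k=0,1,\ldots,T-1}$ (a Hermitian nonnegative definite matrix). Then for all $n,\tau\in{\bf W}$ the covariance function of the process has the spectral representation $$R_n^H(\tau):=\mathrm{Cov}\big(X(\alpha^n),X(\alpha^{n+\tau})\big)=\alpha^{(2n+\tau)H}\sum_{k=0}^{T-1}B_k(\tau)e^{2k\pi i n/T},$$ where $$B_k(\tau)=\int_0^{2\pi}e^{i\tau\omega}f_k(\omega)\,d\omega$$ and $$f_{jk}(\omega)=\frac1T f_{k-j}\big((\omega-2\pi j)/T\big),\qquad j,k=0,1,\ldots,T-1,\quad 0\le\omega<2\pi .$$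
   Context: Processes are real-valued. A zero-mean process $\{X(\alpha^n),n\in{\bf W}\}$ is DT-SI (in the wide sense) with index $H>0$ and scale $l=\alpha^T$ if $E[X^2(\alpha^n)]<\infty$ for all $n\in{\bf W}$ and $E[X(\alpha^{n+T})X(\alpha^{m+T})]=\alpha^{2TH}E[X(\alpha^n)X(\alpha^m)]$ for all $n,m\in{\bf W}$. A zero-mean second order process $\{Y(n)\}$ is discrete time periodically correlated (DT-PC) with period $T$ if $R_n(\tau):=\mathrm{Cov}(Y(n),Y(n+\tau))$ satisfies $R_{n+T}(\tau)=R_n(\tau)$; by this periodicity $R_n(\tau)$ is defined for all $n,\tau\in\mathbb{Z}$. Spectral densities of a DT-PC process (Gladyshev): one has $R_n(\tau)=\sum_{k=0}^{T-1}B_k(\tau)e^{2k\pi in/T}$ with $B_k(\tau)=\frac1T\sum_{n=0}^{T-1}R_n(\tau)e^{-2k\pi i n/T}$, and each $B_k(\tau)$, $\tau\in\mathbb{Z}$, is the Fourier transform $\int_{[0,2\pi)}e^{i\tau\omega}F_k(d\omega)$ of a complex measure $F_k$ on $[0,2\pi)$. Standing assumption: these measures are absolutely continuous; $f_k$ denotes the density of $F_k$, $k=0,\ldots,T-1$. The functions $f_k$ are extended to all $k\in\mathbb{Z}$ and $\omega\in\mathbb{R}$ by $f_{k+T}(\omega)=f_k(\omega)$ and $f_k(\omega+2\pi)=f_k(\omega)$. The spectral density matrix $[f_{jk}(\omega)]$ of $Y$ is the $T\times T$ matrix related to the $f_k$ by the last displayed formula of the claim; Hermitian and nonnegative definite is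 understood for almost every $\omega$. *)

(* Defs.v *)
From HB Require Import structures.
From mathcomp Require Import all_boot all_order all_algebra.
From mathcomp Require Import all_classical all_reals all_analysis.
From mathcomp.real_closed Require Import complex.

Set Implicit Arguments.
Unset Strict Implicit.
Unset Printing Implicit Defensive.

Import Order.TTheory GRing.Theory Num.Theory.
Import numFieldNormedType.Exports.

Local Open Scope classical_set_scope.
Local Open Scope ring_scope.
Local Open Scope complex_scope.
Local Open Scope sesquilinear_scope.

Definition expi {R : realType} (t : R) : R[i] := cos t +i* sin t.

Definition Cintegrable d (U : measurableType d) (R : realType)
    (mu : {measure set U -> \bar R}) (D : set U) (g : U -> R[i]) : Prop :=
  mu.-integrable D (fun x => (complex.Re (g x))%:E) /\
  mu.-integrable D (fun x => (complex.Im (g x))%:E).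

Definition Cintegral d (U : measurableType d) (R : realType)
    (mu : {measure set U -> \bar R}) (D : set U) (g : U -> R[i]) : R[i] :=
  (\int[mu]_(x in D) complex.Re (g x)) +i* (\int[mu]_(x in D) complex.Im (g x)).

(* The integral against a signed measure is the difference of the integrals
   against the two parts of its Jordan decomposition; these parts do not depend
   on the Hahn decomposition selected here. *)
Definition charge_integral d (U : measurableType d) (R : realType)
    (nu : {charge set U -> \bar R}) (D : set U) (g : U -> R) : R :=
  let hP := cid (Hahn_decomposition nu) in
  let hN := cid (svalP hP) in
  \int[jordan_pos (svalP hN)]_(x in D) g x
  - \int[jordan_neg (svalP hN)]_(x in D) g x.

Record complex_measure d (U : measurableType d) (R : realType) := ComplexMeasure
  { cm_re : {charge set U -> \bar R} ; cm_im : {charge set U -> \bar R} }.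

Definition cm_val d (U : measurableType d) (R : realType)
    (F : complex_measure U R) (A : set U) : R[i] :=
  fine (cm_re F A) +i* fine (cm_im F A).

Definition cm_integral d (U : measurableType d) (R : realType)
    (F : complex_measure U R) (D : set U) (g : U -> R[i]) : R[i] :=
  (charge_integral (cm_re F) D (fun x => complex.Re (g x))
   - charge_integral (cm_im F) D (fun x => complex.Im (g x)))
  +i* (charge_integral (cm_re F) D (fun x => complex.Im (g x))
       + charge_integral (cm_im F) D (fun x => complex.Re (g x))).

(* Having such an f is absolute continuity of F on D. *)
Definition has_density d (U : measurableType d) (R : realType)
    (mu : {measure set U -> \bar R}) (D : set U)
    (F : complex_measure U R) (f : U -> R[i]) : Prop :=
  Cintegrable mu D f /\
  forall A, measurable A -> A `<=` D -> cm_val F A = Cintegral mu A f.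

Section processes.
Context d (Om : measurableType d) (R : realType) (P : probability Om R).

(* Only the values X (alpha ^+ n), n : nat, are constrained. *)
Definition DTSI (alpha H : R) (T : nat) (X : R -> {RV P >-> R}) : Prop :=
  [/\ forall n : nat, ('E_P[X (alpha ^+ n)%R] = 0)%E,
      forall n : nat, ('E_P[((X (alpha ^+ n) : Om -> R) ^+ 2)%R] < +oo)%E &
      forall n m : nat,
        ('E_P[((X (alpha ^+ (n + T)) : Om -> R) * X (alpha ^+ (m + T)))%R] =
         (alpha `^ (2 * T%:R * H))%:E *
         'E_P[((X (alpha ^+ n) : Om -> R) * X (alpha ^+ m))%R])%E ].

Definition PC_counterpart (alpha H : R) (X : R -> {RV P >-> R})
    (n : nat) : {RV P >-> R} :=
  alpha `^ (- (n%:R * H)) *: X (alpha ^+ n).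

Definition Cov (U V : {RV P >-> R}) : R := fine (covariance P U V).

Definition DTPC (T : nat) (Y : nat -> {RV P >-> R}) : Prop :=
  [/\ forall n : nat, ('E_P[Y n] = 0)%E,
      forall n : nat, ('E_P[((Y n : Om -> R) ^+ 2)%R] < +oo)%E &
      forall (n : nat) (tau : int), 0 <= n%:Z + tau ->
        Cov (Y (n + T)%N) (Y (absz ((n + T)%N%:Z + tau))) =
        Cov (Y n) (Y (absz (n%:Z + tau))) ].

(* R_n(tau) for arbitrary integers n and tau: both time indices are translated
   by a multiple of T that makes them nonnegative (for T > 0). *)
Definition PCcov (T : nat) (Y : nat -> {RV P >-> R}) (n tau : int) : R :=
  let s : int := (`|n| + `|tau|) * T%:Z in
  Cov (Y (absz (n + s))) (Y (absz (n + tau + s))).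

Definition PCcoef (T : nat) (Y : nat -> {RV P >-> R}) (k : nat) (tau : int)
    : R[i] :=
  T%:R^-1 * \sum_(n < T)
    (PCcov T Y n tau)%:C * expi (- (2 * k%:R * pi * n%:R / T%:R)).

Definition spectral_measures (T : nat) (Y : nat -> {RV P >-> R})
    (F : 'I_T -> complex_measure (measurableTypeR R) R) : Prop :=
  forall (k : 'I_T) (tau : int),
    PCcoef T Y k tau = cm_integral (F k) `[0, 2 * pi[ (fun w => expi (tau%:~R * w)).

Definition spectral_densities (T : nat) (Y : nat -> {RV P >-> R})
    (f : int -> R -> R[i]) : Prop :=
  (exists2 F : 'I_T -> complex_measure (measurableTypeR R) R,
     spectral_measures Y F &
     forall k : 'I_T, has_density (@lebesgue_measure R) `[0, 2 * pi[ (F k) (f k)) /\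
  (forall k w, f (k + T%:Z) w = f k w) /\
  (forall k w, f k (w + 2 * pi) = f k w).

End processes.

Definition spectral_density_matrix (R : realType) (T : nat)
    (f : int -> R -> R[i]) (w : R) : 'M[R[i]]_T :=
  \matrix_(j < T, k < T)
    (T%:R^-1 * f (k%:Z - j%:Z) ((w - 2 * pi * j%:R) / T%:R)).

Definition nonneg_definite (C : numClosedFieldType) (n : nat) (A : 'M[C]_n) : Prop :=
  forall u : 'rV[C]_n, 0 <= (u *m A *m u ^t*) 0 0.

(* Main.v *)
Require Import Defs.
From HB Require Import structures.
From mathcomp Require Import all_boot all_order all_algebra.
From mathcomp Require Import all_classical all_reals all_analysis.
From mathcomp.real_closed Require Import complex.
From mathcomp Require Import measurable_realfun ring lra zify.

Set Implicit Arguments.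
Unset Strict Implicit.
Unset Printing Implicit Defensive.

Import Order.TTheory GRing.Theory Num.Theory.
Import numFieldNormedType.Exports.

Local Open Scope classical_set_scope.
Local Open Scope ring_scope.
Local Open Scope complex_scope.

(** The integral of [expi (tau * w)] against [F k] becomes an integral against
    [f k] by a Radon-Nikodym argument on the Jordan parts, and the formula for
    the covariance is the inversion of the discrete Fourier transform over
    [0 <= k < T].

    For the positivity, [E |\sum_m c_m Y(m)| ^ 2 >= 0] says that the quadratic
    form [\sum_k \int p(x) conj(p(x - 2 pi k / T)) f_k(x) dx] is nonnegative at
    every trigonometric polynomial [p].  Let [p] tend boundedly and almost
    everywhere to the function equal to [u_j] on the arc [J - 2 pi j / T], where
    [J] is an arc of length at most [2 pi / T]: the translates of [J] are
    disjoint, so the limit of the form is the integral over [J] of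
    [\sum_(j, l) u_j conj(u_l) f_(l-j)(x - 2 pi j / T)].  Lebesgue's
    differentiation theorem makes this function nonnegative almost everywhere
    for each fixed [u]; Gaussian integer vectors [u] are countably many and
    suffice by homogeneity and density. *)

(** * Unit complex numbers *)

(** The quadratic form in [p] has its shape because the k-th coefficient contributes e^(i(m - m')x)
    e^(2 pi i k m'/T) to the covariance of Y(m) and Y(m'), and this product is e^(imx) times the
    conjugate of e^(im'(x - 2 pi k/T)). The densities are merely integrable, so mean-square
    approximation of indicators would not suffice: the polynomials have to be uniformly bounded and
    converge almost everywhere, so that dominated convergence applies. Explicit powers of an affine
    function of a cosine do this, and they are trigonometric polynomials by closure under sums and
    products. The length bound on the arc makes each pair (j, l) select a single k, the residue of l
    - j modulo T; otherwise several densities would be mixed in one term. Hermitian symmetry is not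
    derived from relations between the [f k]: it follows from nonnegativity on complex vectors. The
    matrix at w is, up to the factor 1/T, the matrix of the form at w/T, whence the dilation at the
    end. *)

Section expi_theory.
Context {R : realType}.
Implicit Types (x y : R) (z : R[i]).

Lemma expiD x y : expi (x + y) = expi x * expi y.
Proof. by rewrite /expi cosD sinD; simpc; rewrite (addrC (sin x * _)). Qed.

Lemma expi0 : expi (0 : R) = 1.
Proof. by rewrite /expi cos0 sin0. Qed.

Lemma expiMn x n : expi (x *+ n) = expi x ^+ n.
Proof. by elim: n => [|n IH]; rewrite ?expi0 // mulrS exprS expiD IH. Qed.

Lemma expiN x : expi (- x) = (expi x)^*%R.
Proof. by rewrite /expi cosN sinN. Qed.

Lemma expi_2pi : expi (2 * pi : R) = 1.
Proof. by rewrite mulr_natl /expi cos2pi sin2pi. Qed.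

Lemma expi_2piz (m : int) : expi (2 * pi * m%:~R : R) = 1.
Proof.
have Hn (n : nat) : expi (2 * pi * n%:R : R) = 1.
  by rewrite mulr_natr expiMn expi_2pi expr1n.
case: m => n; first exact: Hn.
by rewrite NegzE mulrNz mulrN expiN Hn rmorph1.
Qed.

Lemma expi_eq1 x : expi x = 1 -> exists m : int, x = 2 * pi * m%:~R.
Proof.
have pi0 : 0 < 2 * pi :> R by rewrite mulr_gt0 // pi_gt0.
move=> ex; pose m := Num.floor (x / (2 * pi)); exists m.
pose y := x - 2 * pi * m%:~R.
have ey : expi y = 1.
  by rewrite /y expiD ex mul1r -mulrN -mulrNz expi_2piz.
have y0 : 0 <= y.
  rewrite subr_ge0 mulrC -ler_pdivlMr //; exact: floor_le.
have y2 : y < 2 * pi.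
  have : x / (2 * pi) < (m + 1)%:~R by exact: floorD1_gt.
  by rewrite ltr_pdivrMr // intrD /y; lra.
suff : y = 0 by move/eqP; rewrite subr_eq0 => /eqP.
(* Comparing components gives [cos y = 1] and [sin y = 0]. On ]0, pi[ the sine is positive, on ]pi,
   2 pi[ its reflection is, and at pi the cosine is -1. *)
move: ey => [cy sy]; apply/eqP; rewrite eq_le y0 andbT leNgt; apply/negP => yp.
have [yl|yg] := ltP y pi.
  by have := @sin_gt0_pi _ y; rewrite yp yl sy ltxx => /(_ isT).
have : pi < y \/ y = pi.
  by move: yg; rewrite le_eqVlt => /orP[/eqP->|]; [right|left].
case=> [yg'|yE].
  have : 0 < sin (2 * pi - y) by apply: sin_gt0_pi; lra.
  by rewrite addrC mulr_natl sinD2pi sinN sy oppr0 ltxx.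
have := @cospi R; rewrite -yE cy; lra.
Qed.

(** Geometric sum of [w] with [w ^+ T = 1]: it vanishes unless [w = 1], which by [expi_eq1] happens
    exactly when T divides m. *)
Lemma expi_root_unity (T : nat) (m : int) : (0 < T)%N ->
  \sum_(k < T) expi (2 * pi * (k%:R * m%:~R) / T%:R : R) =
    if (T %| m)%Z then T%:R else 0.
Proof.
move=> T0; have T0' : (T%:R : R) != 0 by rewrite pnatr_eq0 -lt0n.
set w := expi (2 * pi * m%:~R / T%:R : R).
have E (k : 'I_T) : expi (2 * pi * (k%:R * m%:~R) / T%:R : R) = w ^+ k.
  rewrite /w -expiMn; congr expi.
  by rewrite -[RHS]mulr_natl (mulrCA (2 * pi)) [RHS]mulrA.
under eq_bigr do rewrite E.
have wT : w ^+ T = 1.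
  rewrite -expiMn -(expi_2piz m); congr expi.
  by rewrite -[LHS]mulr_natr divfK.
have [w1|w1] := eqVneq w 1.
  under eq_bigr do rewrite w1 expr1n.
  rewrite sumr_const card_ord.
  have [q Hq] := expi_eq1 w1.
  suff -> : (T %| m)%Z by [].
  apply/dvdzP; exists q; apply/eqP; rewrite -(@eqr_int R) intrM; apply/eqP.
  have p0 : (2 * pi : R) != 0 by rewrite mulf_neq0 ?pnatr_eq0 // gt_eqF // pi_gt0.
  by apply: (mulfI p0); rewrite mulrA -Hq -pmulrn divfK.
have -> : (T %| m)%Z = false.
  apply/negP => /dvdzP[q Hq]; move/negP: w1; apply; apply/eqP.
  rewrite /w Hq intrM -pmulrn -(expi_2piz q); congr expi.
  by rewrite mulrA mulfK.
apply/eqP; have := subrX1 w T; rewrite wT subrr => /esym/eqP.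
by rewrite mulf_eq0 subr_eq0 (negbTE w1).
Qed.

End expi_theory.

(** * Componentwise limits and integrals of complex functions *)

Section complex_parts.
Context {R : realType}.
Implicit Types (x y z : R[i]).

Lemma cReD x y : @complex.Re R (x + y) = complex.Re x + complex.Re y.
Proof. by case: x; case: y. Qed.

Lemma cImD x y : @complex.Im R (x + y) = complex.Im x + complex.Im y.
Proof. by case: x; case: y. Qed.

Lemma cReN x : @complex.Re R (- x) = - complex.Re x.
Proof. by case: x. Qed.

Lemma cImN x : @complex.Im R (- x) = - complex.Im x.
Proof. by case: x. Qed.

Lemma cReM x y : @complex.Re R (x * y) =
  complex.Re x * complex.Re y - complex.Im x * complex.Im y.
Proof. by case: x; case: y. Qed.

Lemma cImM x y : @complex.Im R (x * y) =
  complex.Re x * complex.Im y + complex.Im x * complex.Re y.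
Proof. by case: x; case: y. Qed.

Lemma cReJ x : @complex.Re R x^*%R = complex.Re x.
Proof. by case: x. Qed.

Lemma cImJ x : @complex.Im R x^*%R = - complex.Im x.
Proof. by case: x. Qed.

Lemma eq_complexP x y :
  complex.Re x = complex.Re y -> complex.Im x = complex.Im y -> x = y.
Proof. by case: x; case: y => a b c d /= -> ->. Qed.

Lemma complex_ge0 z : (0 <= z) = (complex.Im z == 0) && (0 <= complex.Re z).
Proof. by case: z => a b; rewrite lecE /=. Qed.

End complex_parts.

Section complex_limits.
Context {R : realType}.
Implicit Types (u v : nat -> R[i]) (a b : R[i]).

Definition Ccvg u a : Prop :=
  (complex.Re (u n) @[n --> \oo] --> complex.Re a) /\
  (complex.Im (u n) @[n --> \oo] --> complex.Im a).

Lemma Ccvg_cst a : Ccvg (fun=> a) a.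
Proof. by split; exact: cvg_cst. Qed.

Lemma CcvgD u v a b : Ccvg u a -> Ccvg v b -> Ccvg (fun n => u n + v n) (a + b).
Proof.
move=> [ua ua'] [vb vb']; split.
- by rewrite cReD; under eq_fun do rewrite cReD; exact: cvgD.
- by rewrite cImD; under eq_fun do rewrite cImD; exact: cvgD.
Qed.

Lemma CcvgM u v a b : Ccvg u a -> Ccvg v b -> Ccvg (fun n => u n * v n) (a * b).
Proof.
move=> [ua ua'] [vb vb']; split.
- by rewrite cReM; under eq_fun do rewrite cReM; apply: cvgB; exact: cvgM.
- by rewrite cImM; under eq_fun do rewrite cImM; apply: cvgD; exact: cvgM.
Qed.

Lemma Ccvg_conj u a : Ccvg u a -> Ccvg (fun n => (u n)^*%R) a^*%R.
Proof.
move=> [ua ua']; split.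
- by rewrite cReJ; under eq_fun do rewrite cReJ.
- by rewrite cImJ; under eq_fun do rewrite cImJ; exact: cvgN.
Qed.

Lemma Ccvg_sum (I : Type) (r : seq I) (F : I -> nat -> R[i]) (A : I -> R[i]) :
  (forall i, Ccvg (F i) (A i)) ->
  Ccvg (fun n => \sum_(i <- r) F i n) (\sum_(i <- r) A i).
Proof.
move=> FA; elim: r => [|i r IH].
  by rewrite big_nil; under eq_fun do rewrite big_nil; exact: Ccvg_cst.
by rewrite big_cons; under eq_fun do rewrite big_cons; exact: CcvgD.
Qed.

(** The order of [R[i]] makes nonnegativity include a zero imaginary part; both conditions are
    closed. *)
Lemma Ccvg_ge0 u a : Ccvg u a -> (forall n, 0 <= u n) -> 0 <= a.
Proof.
move=> [ua ua'] u0; rewrite complex_ge0; apply/andP; split.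
- rewrite -(cvg_lim _ ua') //; under eq_fun.
    by move=> n; move: (u0 n); rewrite complex_ge0 => /andP[/eqP -> _]; over.
  by rewrite lim_cst.
- rewrite -(cvg_lim _ ua) //; apply: limr_ge; first by apply/cvg_ex; eexists; exact: ua.
  by apply: nearW => n; move: (u0 n); rewrite complex_ge0 => /andP[].
Qed.

End complex_limits.

Section real_integrals.
Context d (U : measurableType d) (R : realType).
Variables (mu : {measure set U -> \bar R}) (D : set U) (mD : measurable D).
Implicit Types f g : U -> R.

Lemma integrable_rsum (I : Type) (r : seq I) (F : I -> U -> R) :
  (forall i, mu.-integrable D (EFin \o F i)) ->
  mu.-integrable D (EFin \o (fun x => \sum_(i <- r) F i x)).
Proof.
move=> iF; elim: r => [|i r IH].
  by under eq_fun do rewrite big_nil; exact: integrable0.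
rewrite (_ : EFin \o _ = (EFin \o F i) \+ (EFin \o (fun x => \sum_(i <- r) F i x))).
  exact: integrableD.
by apply/funext => x /=; rewrite big_cons.
Qed.

Lemma Rintegral_sum (I : Type) (r : seq I) (F : I -> U -> R) :
  (forall i, mu.-integrable D (EFin \o F i)) ->
  \int[mu]_(x in D) (\sum_(i <- r) F i x) = \sum_(i <- r) \int[mu]_(x in D) F i x.
Proof.
move=> iF; elim: r => [|i r IH].
  rewrite big_nil -[RHS](Rintegral_set0 mu (fun=> 0)).
  under eq_Rintegral do rewrite big_nil.
  by rewrite /Rintegral !integral0.
rewrite big_cons -IH -RintegralD //; last exact: integrable_rsum.
by apply: eq_Rintegral => x _; rewrite big_cons.
Qed.

Lemma integrableZ_r (k : R) f : mu.-integrable D (EFin \o f) ->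
  mu.-integrable D (EFin \o (fun x => k * f x)).
Proof.
move=> fi; rewrite (_ : EFin \o _ = (fun x => k%:E * (EFin \o f) x)%E) //.
exact: integrableZl.
Qed.

Lemma integrable_mul_bounded f g (M : R) : measurable_fun D g ->
  (forall x, `|g x| <= M) -> mu.-integrable D (EFin \o f) ->
  mu.-integrable D (EFin \o (fun x => g x * f x)).
Proof.
move=> mg gM fi; have mf := measurable_int _ fi.
apply: (@le_integrable _ _ _ mu D mD _ (EFin \o (fun x => M * f x))) => //.
- by apply/measurable_EFinP; apply: measurable_funM => //; exact/measurable_EFinP.
- move=> x _; rewrite /= lee_fin !normrM ler_wpM2r //.
  by rewrite (le_trans (gM x)) // ler_norm.
- exact: integrableZ_r.
Qed.

End real_integrals.

Section complex_integrals.
Context d (U : measurableType d) (R : realType).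
Variables (mu : {measure set U -> \bar R}) (D : set U) (mD : measurable D).
Implicit Types f g : U -> R[i].

Lemma eq_Cintegral f g : {in D, f =1 g} -> Cintegral mu D f = Cintegral mu D g.
Proof.
by move=> fg; rewrite /Cintegral; congr (_ +i* _);
  apply: eq_Rintegral => x xD; rewrite fg.
Qed.

Lemma CintegrableD f g : Cintegrable mu D f -> Cintegrable mu D g ->
  Cintegrable mu D (fun x => f x + g x).
Proof.
move=> [f1 f2] [g1 g2]; split.
- by under eq_fun do rewrite cReD EFinD; exact: integrableD.
- by under eq_fun do rewrite cImD EFinD; exact: integrableD.
Qed.

Lemma CintegralD f g : Cintegrable mu D f -> Cintegrable mu D g ->
  Cintegral mu D (fun x => f x + g x) = Cintegral mu D f + Cintegral mu D g.
Proof.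
move=> [f1 f2] [g1 g2]; apply: eq_complexP; rewrite ?cReD ?cImD /=.
- by under eq_Rintegral do rewrite cReD; rewrite RintegralD.
- by under eq_Rintegral do rewrite cImD; rewrite RintegralD.
Qed.

Lemma CintegrableZ (c : R[i]) f : Cintegrable mu D f ->
  Cintegrable mu D (fun x => c * f x).
Proof.
move=> [f1 f2]; split.
- under eq_fun do rewrite cReM EFinB.
  by apply: integrableB => //; exact: integrableZ_r.
- under eq_fun do rewrite cImM EFinD.
  by apply: integrableD => //; exact: integrableZ_r.
Qed.

Lemma CintegralZ (c : R[i]) f : Cintegrable mu D f ->
  Cintegral mu D (fun x => c * f x) = c * Cintegral mu D f.
Proof.
move=> [f1 f2]; apply: eq_complexP; rewrite ?cReM ?cImM /=.
- under eq_Rintegral do rewrite cReM.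
  by rewrite RintegralB ?RintegralZl //; exact: integrableZ_r.
- under eq_Rintegral do rewrite cImM.
  by rewrite RintegralD ?RintegralZl //; exact: integrableZ_r.
Qed.

Lemma Cintegrable0 : Cintegrable mu D (fun=> 0).
Proof. by split; exact: integrable0. Qed.

Lemma Cintegral0 : Cintegral mu D (fun=> 0) = 0.
Proof. by rewrite /Cintegral /Rintegral /= integral0. Qed.

Lemma Cintegrable_sum (I : Type) (r : seq I) (F : I -> U -> R[i]) :
  (forall i, Cintegrable mu D (F i)) ->
  Cintegrable mu D (fun x => \sum_(i <- r) F i x).
Proof.
move=> iF; elim: r => [|i r IH].
  by under eq_fun do rewrite big_nil; exact: Cintegrable0.
by under eq_fun do rewrite big_cons; exact: CintegrableD.
Qed.

Lemma Cintegral_sum (I : Type) (r : seq I) (F : I -> U -> R[i]) :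
  (forall i, Cintegrable mu D (F i)) ->
  Cintegral mu D (fun x => \sum_(i <- r) F i x) =
  \sum_(i <- r) Cintegral mu D (F i).
Proof.
move=> iF; elim: r => [|i r IH].
  by rewrite big_nil; under eq_fun do rewrite big_nil; exact: Cintegral0.
rewrite big_cons -IH -CintegralD //; last exact: Cintegrable_sum.
by under eq_fun do rewrite big_cons.
Qed.

Lemma Cintegrable_mul_bounded f g (M : R) :
  measurable_fun D (fun x => complex.Re (g x)) ->
  measurable_fun D (fun x => complex.Im (g x)) ->
  (forall x, `|complex.Re (g x)| <= M) ->
  (forall x, `|complex.Im (g x)| <= M) ->
  Cintegrable mu D f -> Cintegrable mu D (fun x => g x * f x).
Proof.
move=> mr mi bR bI [f1 f2]; split.
- under eq_fun do rewrite cReM EFinB.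
  by apply: integrableB => //; exact: (@integrable_mul_bounded _ _ _ _ _ _ _ _ M).
- under eq_fun do rewrite cImM EFinD.
  by apply: integrableD => //; exact: (@integrable_mul_bounded _ _ _ _ _ _ _ _ M).
Qed.

End complex_integrals.

(** * Second order processes *)

Section second_order.
Context d (Om : measurableType d) (R : realType) (P : probability Om R).
Implicit Types U V : {RV P >-> R}.

Lemma expectationEFin (g : Om -> R) : ('E_P[g])%E = (\int[P]_w (g w)%:E)%E.
Proof. by rewrite unlock. Qed.

Lemma integrable_sqr U : ('E_P[((U : Om -> R) ^+ 2)%R] < +oo)%E ->
  P.-integrable setT (EFin \o (fun w => U w ^+ 2)).
Proof.
rewrite expectationEFin => U2; apply/integrableP; split.
  by apply/measurable_EFinP; apply: measurable_funX.
rewrite (eq_integral (fun w => (((U : Om -> R) ^+ 2)%R w)%:E)) // => w _ /=.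
by rewrite ger0_norm ?sqr_ge0.
Qed.

(** Domination by U^2 + V^2, from (|U| - |V|)^2 >= 0. *)
Lemma integrable_mul U V :
  ('E_P[((U : Om -> R) ^+ 2)%R] < +oo)%E ->
  ('E_P[((V : Om -> R) ^+ 2)%R] < +oo)%E ->
  P.-integrable setT (EFin \o (fun w => U w * V w)).
Proof.
move=> /integrable_sqr U2 /integrable_sqr V2.
apply: (@le_integrable _ _ _ P setT measurableT _
   ((EFin \o (fun w => U w ^+ 2)) \+ (EFin \o (fun w => V w ^+ 2)))).
- by apply/measurable_EFinP; apply: measurable_funM.
- move=> w _; rewrite /= lee_fin normrM.
  rewrite [leRHS]ger0_norm ?addr_ge0 ?sqr_ge0 //.
  rewrite -(real_normK (num_real (U w))) -(real_normK (num_real (V w))).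
  have := sqr_ge0 (`|U w| - `|V w|); have := normr_ge0 (U w).
  have := normr_ge0 (V w); nra.
- exact: integrableD.
Qed.

Lemma Cov_centered U V : ('E_P[U] = 0)%E -> ('E_P[V] = 0)%E ->
  Cov U V = \int[P]_w (U w * V w).
Proof.
move=> U0 V0; rewrite /Cov unlock U0 V0 expectationEFin /Rintegral.
by congr fine; apply: eq_integral => w _ /=; rewrite !fctE /= !subr0.
Qed.

Lemma Cov_sym U V : Cov U V = Cov V U.
Proof. by rewrite /Cov covarianceC. Qed.

(** The double sum is the expectation of the square of [\sum_(i <- r) x i * Z i]. *)
Lemma Cov_nonneg (I : Type) (r : seq I) (x : I -> R) (Z : I -> {RV P >-> R}) :
  (forall i, 'E_P[Z i] = 0)%E ->
  (forall i, 'E_P[((Z i : Om -> R) ^+ 2)%R] < +oo)%E ->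
  0 <= \sum_(i <- r) \sum_(j <- r) x i * x j * Cov (Z i) (Z j).
Proof.
move=> Z0 Z2.
have iZ i j : P.-integrable setT (EFin \o (fun w => x i * x j * (Z i w * Z j w))).
  by apply: integrableZ_r => //; exact: integrable_mul.
have -> : \sum_(i <- r) \sum_(j <- r) x i * x j * Cov (Z i) (Z j) =
    \int[P]_w (\sum_(i <- r) \sum_(j <- r) x i * x j * (Z i w * Z j w)).
  rewrite Rintegral_sum //; last by move=> i; exact: integrable_rsum.
  apply: eq_bigr => i _; rewrite Rintegral_sum //; apply: eq_bigr => j _.
  by rewrite RintegralZl ?Cov_centered //; exact: integrable_mul.
apply: Rintegral_ge0 => w _.
rewrite (_ : \sum_(i <- r) _ = (\sum_(i <- r) x i * Z i w) ^+ 2) ?sqr_ge0 //.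
rewrite expr2 mulr_suml; apply: eq_bigr => i _; rewrite mulr_sumr.
by apply: eq_bigr => j _; ring.
Qed.

(** With c = a + ib, the real part is the sum of the real forms at a and at b, and the imaginary
    part cancels by symmetry of [Cov]. *)
Lemma Cov_nonneg_complex (I : Type) (r : seq I) (c : I -> R[i])
    (Z : I -> {RV P >-> R}) :
  (forall i, 'E_P[Z i] = 0)%E ->
  (forall i, 'E_P[((Z i : Om -> R) ^+ 2)%R] < +oo)%E ->
  0 <= \sum_(i <- r) \sum_(j <- r) c i * (c j)^* * (Cov (Z i) (Z j))%:C.
Proof.
move=> Z0 Z2; pose a i := complex.Re (c i); pose b i := complex.Im (c i).
set S := (X in 0 <= X).
have -> : S = (\sum_(i <- r) \sum_(j <- r) a i * a j * Cov (Z i) (Z j) +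
               \sum_(i <- r) \sum_(j <- r) b i * b j * Cov (Z i) (Z j))%:C +
   'i%C * ((\sum_(i <- r) \sum_(j <- r) b i * a j * Cov (Z i) (Z j))%:C -
         (\sum_(i <- r) \sum_(j <- r) a i * b j * Cov (Z i) (Z j))%:C).
  rewrite /S !rmorphD !rmorph_sum -big_split -sumrB mulr_sumr -big_split.
  apply: eq_bigr => i _.
  rewrite !rmorph_sum -big_split -sumrB mulr_sumr -big_split.
  apply: eq_bigr => j _; apply: eq_complexP;
    rewrite !(cReD, cReN, cReM, cImD, cImN, cImM, cReJ, cImJ) /= /a /b; ring.
rewrite [X in 'i%C * (_ - X)](_ : _ =
    (\sum_(i <- r) \sum_(j <- r) b i * a j * Cov (Z i) (Z j))%:C).
  rewrite subrr mulr0 addr0 lecE /= eqxx /=.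
  by rewrite addr_ge0 // Cov_nonneg.
congr (_%:C); rewrite exchange_big; apply: eq_bigr => i _; apply: eq_bigr => j _.
by rewrite Cov_sym (mulrC (a _)).
Qed.

End second_order.

(** * Covariances at integer times and their discrete Fourier inversion *)

Section periodically_correlated.
Context d (Om : measurableType d) (R : realType) (P : probability Om R).
Variables (T : nat) (T0 : (0 < T)%N) (Y : nat -> {RV P >-> R}).
Hypothesis YPC : DTPC T Y.

Lemma DTPC_Cov_shift (n m q : nat) :
  Cov (Y (n + q * T)%N) (Y (m + q * T)%N) = Cov (Y n) (Y m).
Proof.
have [_ _ per] := YPC; elim: q => [|q IH]; first by rewrite !mul0n !addn0.
rewrite -IH; have := per (n + q * T)%N (m%:Z - n%:Z).
rewrite (_ : absz _ = (m + q * T + T)%N); last by lia.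
rewrite (_ : absz _ = (m + q * T)%N); last by lia.
by move=> <-; [rewrite !mulSn; congr (Cov (Y _) (Y _)); lia | lia].
Qed.

(** The multiple of T chosen in [PCcov] is immaterial: shifting each side by the multiple of the
    other brings both to the total shift [(s + s') * T]. *)
Lemma PCcovE (n tau : int) (s : nat) :
  0 <= n + (s * T)%N%:Z -> 0 <= n + tau + (s * T)%N%:Z ->
  PCcov T Y n tau =
  Cov (Y (absz (n + (s * T)%N%:Z))) (Y (absz (n + tau + (s * T)%N%:Z))).
Proof.
move=> n0 m0; rewrite /PCcov; set s' := (absz n + absz tau)%N.
have -> : (`|n| + `|tau|) * T%:Z = (s' * T)%N%:Z :> int.
  by rewrite PoszM PoszD !abszE.
have n1 : 0 <= n + (s' * T)%N%:Z.
  by have : (s' <= s' * T)%N; [exact: leq_pmulr | lia].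
have m1 : 0 <= n + tau + (s' * T)%N%:Z.
  by have : (s' <= s' * T)%N; [exact: leq_pmulr | lia].
rewrite -[LHS](DTPC_Cov_shift _ _ s) -[RHS](DTPC_Cov_shift _ _ s').
by congr (Cov (Y _) (Y _)); lia.
Qed.

Lemma PCcov_nat (n tau : nat) :
  PCcov T Y n tau = Cov (Y n) (Y (n + tau)%N).
Proof. by rewrite (@PCcovE _ _ 0) // mul0n !addr0. Qed.

Lemma PCcov_period (n tau q : int) :
  PCcov T Y (n + q * T%:Z) tau = PCcov T Y n tau.
Proof.
(* Since q may be negative, [a] extra periods are added on the left; the two sides then differ by
   [q + a >= 0] periods. *)
pose s := (absz n + absz tau)%N; pose a := absz q.
have sT : (s <= s * T)%N by exact: leq_pmulr.
have qT : 0 <= a%:Z * T%:Z + q * T%:Z by rewrite -mulrDl mulr_ge0 //; lia.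
rewrite (@PCcovE _ _ (s + a)) ?mulnDl ?PoszD ?PoszM; try by lia.
pose b := absz (q + a%:Z).
have bE : q * T%:Z + a%:Z * T%:Z = (b * T)%N%:Z.
  by rewrite PoszM -mulrDl; congr (_ * _); lia.
rewrite (@PCcovE n _ s); try by lia.
rewrite -[RHS](DTPC_Cov_shift _ _ b).
by congr (Cov (Y _) (Y _)); lia.
Qed.

Lemma PCcoef_inversion (n tau : int) :
  (PCcov T Y n tau)%:C =
  \sum_(k < T) PCcoef T Y k tau * expi (2 * k%:R * pi * n%:~R / T%:R).
Proof.
have TC : (T%:R : R[i]) != 0 by rewrite pnatr_eq0 -lt0n.
rewrite (eq_bigr (fun k : 'I_T => \sum_(j < T) T%:R^-1 *
    (PCcov T Y j tau)%:C *
    expi (2 * pi * (k%:R * (n - j%:Z)%:~R) / T%:R))); last first.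
  move=> k _; rewrite /PCcoef -[LHS]mulrA mulr_suml mulr_sumr.
  apply: eq_bigr => j _; rewrite -[RHS]mulrA; congr (_ * _).
  rewrite -[LHS]mulrA -expiD; congr (_ * expi _).
  rewrite intrD mulrNz -pmulrn; move: (T%:R^-1) => t.
  move: (nat_of_ord k)%:R (nat_of_ord j)%:R (n%:~R : R) => x y z; ring.
(* The sum over k is now a sum of roots of unity, which keeps only the j congruent to n modulo T. *)
rewrite exchange_big /=.
rewrite (eq_bigr (fun j : 'I_T => T%:R^-1 * (PCcov T Y j tau)%:C *
    (if (T %| (n - j%:Z))%Z then T%:R else 0))); last first.
  by move=> j _; rewrite -mulr_sumr expi_root_unity.
have jlt : (absz (modz n T) < T)%N.
  by have := @ltz_pmod n T; have := @modz_ge0 n T; lia.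
rewrite (bigD1 (Ordinal jlt)) //= big1 ?addr0; last first.
  move=> j jn; case: ifPn => [/dvdzP[q qE]|]; last by rewrite mulr0.
  case/eqP: jn; apply/val_inj => /=; have -> : n = q * T + j by lia.
  by rewrite modzMDl modz_small //; have := ltn_ord j; lia.
have nE := divz_eq n T; have m0 := @modz_ge0 n T.
have -> : (T %| (n - (absz (modz n T))%:Z))%Z.
  by apply/dvdzP; exists (divz n T); rewrite {1}nE; lia.
rewrite mulrAC mulVf // mul1r {1}nE; congr (_%:C).
rewrite addrC PCcov_period; congr (PCcov T Y _ tau).
by rewrite gez0_abs //; apply: m0; lia.
Qed.

(** This is E |\sum_i c_i Y(m_i)|^2 >= 0 at integer times: finitely many times become natural
    numbers after one common shift by [M * T]. The list predicate [List.In] serves because [I] is a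
    bare type. *)
Lemma PCcov_nonneg (I : Type) (r : seq I) (c : I -> R[i]) (m : I -> int) :
  0 <= \sum_(i <- r) \sum_(j <- r) c i * (c j)^* *
         (PCcov T Y (m j) (m i - m j))%:C.
Proof.
have [Y0 Y2 _] := YPC.
have [M Mm] : exists M : nat, forall i, List.In i r -> (absz (m i) <= M)%N.
  elim: r => [|i r [M IH]]; first by exists 0%N.
  exists (M + absz (m i))%N => j /= [<-|/IH]; lia.
have MT : (M <= M * T)%N by exact: leq_pmulr.
pose Z i := Y (absz (m i + (M * T)%N%:Z)).
have E i j : List.In i r -> List.In j r ->
    PCcov T Y (m j) (m i - m j) = Cov (Z i) (Z j).
  move=> /Mm iM /Mm jM; rewrite (@PCcovE _ _ M); try by lia.
  by rewrite (addrC (m j) (m i - m j)) subrK Cov_sym.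
rewrite (_ : \sum_(i <- r) _ =
  \sum_(i <- r) \sum_(j <- r) c i * (c j)^* * (Cov (Z i) (Z j))%:C).
  by apply: (@Cov_nonneg_complex _ _ _ _ I r c Z) => i; [exact: Y0|exact: Y2].
have big_In (G G' : I -> R[i]) (s : seq I) :
    (forall i, List.In i s -> G i = G' i) ->
    \sum_(i <- s) G i = \sum_(i <- s) G' i.
  elim: s => [|i s IH] GG; first by rewrite !big_nil.
  rewrite !big_cons GG ?IH //; last by left.
  by move=> j js; apply: GG; right.
by apply: (big_In) => i ir; apply: big_In => j jr; rewrite E.
Qed.

End periodically_correlated.

(** * From scale invariance to periodic correlation *)

Section scale_invariant.
Context d (Om : measurableType d) (R : realType) (P : probability Om R).
Variables (alpha H : R) (T : nat) (X : R -> {RV P >-> R}).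
Hypothesis alpha0 : 0 < alpha.
Hypothesis XSI : DTSI alpha H T X.
Let Y := PC_counterpart alpha H X.

Lemma PC_counterpart_centered n : ('E_P[Y n] = 0)%E.
Proof.
have [X0 X2 _] := XSI; move: (X0 n).
rewrite !expectationEFin => X0n.
rewrite (_ : (fun w => _) = (fun w => (alpha `^ (- (n%:R * H)))%:E *
    (X (alpha ^+ n) w)%:E)%E) //.
rewrite integralZl //= ?X0n ?mule0 //.
(* Taking the scalar out of the expectation needs [X (alpha ^+ n)] integrable; |x| <= x^2 + 1 and
   finiteness of [P] give it. *)
have N2 := integrable_sqr (X2 n).
have c1 : P.-integrable setT (EFin \o cst (1 : R)).
  by apply: finite_measure_integrable_cst.
apply: (@le_integrable _ _ _ P setT measurableT _ _ _ _ (integrableD measurableT N2 c1)).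
  by apply/measurable_EFinP.
move=> w _; rewrite /= lee_fin [leRHS]ger0_norm ?addr_ge0 ?sqr_ge0 //.
rewrite -(real_normK (num_real (X _ w))).
by have := normr_ge0 (X (alpha ^+ n) w); nra.
Qed.

Lemma PC_counterpart_sqr n : ('E_P[((Y n : Om -> R) ^+ 2)%R] < +oo)%E.
Proof.
have [_ X2 _] := XSI; rewrite expectationEFin.
rewrite (_ : (fun w => _) = (fun w => (alpha `^ (- (n%:R * H)) ^+ 2)%:E *
    (X (alpha ^+ n) w ^+ 2)%:E)%E); last first.
  by apply/funext => w; rewrite -EFinM -exprMn.
have := integrable_sqr (X2 n) => iX.
rewrite integralZl // ltey_eq fin_numM //.
by apply: (integrable_fin_num measurableT iX).
Qed.

Lemma Cov_PC_counterpart n m : Cov (Y n) (Y m) =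
  alpha `^ (- ((n + m)%:R * H)) * Cov (X (alpha ^+ n)) (X (alpha ^+ m)).
Proof.
have [X0 X2 _] := XSI.
rewrite !Cov_centered //; try exact: PC_counterpart_centered.
rewrite -RintegralZl //; last exact: integrable_mul.
apply: eq_Rintegral => w _ /=.
rewrite natrD mulrDl opprD powRD; last by rewrite (gt_eqF alpha0) implybT.
rewrite -mulrACA; congr (_ * _).
Qed.

Lemma Cov_DTSI n m :
  Cov (X (alpha ^+ (n + T))) (X (alpha ^+ (m + T))) =
  alpha `^ (2 * T%:R * H) * Cov (X (alpha ^+ n)) (X (alpha ^+ m)).
Proof.
have [X0 X2 Xsi] := XSI; rewrite !Cov_centered // /Rintegral.
have := Xsi n m; rewrite !expectationEFin => ->.
rewrite fineM //.
exact: (integrable_fin_num measurableT (integrable_mul (X2 n) (X2 m))).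
Qed.

(** Shifting both times by T multiplies the normalization by alpha^(-2TH), which cancels the factor
    alpha^(2TH) of scale invariance. *)
Lemma DTSI_DTPC : DTPC T Y.
Proof.
split; [exact: PC_counterpart_centered|exact: PC_counterpart_sqr|].
move=> n tau h; set m := absz (n%:Z + tau).
have -> : absz ((n + T)%N%:Z + tau) = (m + T)%N by rewrite /m; lia.
rewrite !Cov_PC_counterpart Cov_DTSI mulrA -powRD; last first.
  by rewrite (gt_eqF alpha0) implybT.
by congr (alpha `^ _ * _); rewrite !natrD; ring.
Qed.

Lemma Cov_DTSI_counterpart n m : Cov (X (alpha ^+ n)) (X (alpha ^+ m)) =
  alpha `^ ((n + m)%:R * H) * Cov (Y n) (Y m).
Proof.
rewrite Cov_PC_counterpart mulrA -powRD; last by rewrite (gt_eqF alpha0) implybT.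
by rewrite subrr powRr0 mul1r.
Qed.

End scale_invariant.

(** * Integrals against complex measures with a density *)

Section densities.
Context d (U : measurableType d) (R : realType).
Variable mu : {sigma_finite_measure set U -> \bar R}.

(** The measure [m] is controlled only inside [D], so the Radon-Nikodym theorem is applied to its
    restriction [n]. The derivative of [n] equals [h] almost everywhere on [D], both having the same
    integrals over measurable subsets of [D]. *)
Lemma Rintegral_density (m : {finite_measure set U -> \bar R}) (D : set U)
    (h phi : U -> R) (M : R) : measurable D ->
  mu.-integrable D (EFin \o h) ->
  (forall A, measurable A -> A `<=` D -> m A = (\int[mu]_(x in A) (h x)%:E)%E) ->
  measurable_fun D phi -> (forall x, `|phi x| <= M) ->
  \int[m]_(x in D) phi x = \int[mu]_(x in D) (phi x * h x).
Proof.
move=> mD ih mE mphi phiM.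
have moo : (m D < +oo)%E by rewrite ltey_eq fin_num_measure.
pose n : {finite_measure set U -> \bar R} := mfrestr mD moo.
have nE A : measurable A -> n A = (\int[mu]_(x in A `&` D) (h x)%:E)%E.
  by move=> mA; rewrite /n /= /mfrestr /mrestr mE //; exact: measurableI.
have ndom : n `<< mu.
  apply/null_content_dominatesP => A mA A0; rewrite nE //.
  apply: null_set_integral; first exact: measurableI.
  - by apply: measurable_funS (measurable_int _ ih).
  - by apply/eqP; rewrite eq_le measure_ge0 andbT -A0 le_measure ?inE //;
      exact: measurableI.
rewrite /Rintegral; congr fine.
transitivity (\int[n]_(x in D) (phi x)%:E)%E.
  apply: eq_measure_integral => A mA AD.
  by rewrite [LHS]mE // [RHS]nE // setIidl.
have iphi : n.-integrable D (EFin \o phi).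
  apply: (@le_integrable _ _ _ n D mD _ (EFin \o cst M)).
  - exact/measurable_EFinP.
  - by move=> x _; rewrite /= lee_fin (le_trans (phiM x)) // ler_norm.
  - exact: finite_measure_integrable_cst.
rewrite -(Radon_Nikodym_change_of_variables ndom mD iphi).
have ndom' : charge_of_finite_measure n `<< mu := ndom.
have RNi := Radon_Nikodym_integrable ndom'.
apply: ae_eq_integral => //.
- apply: emeasurable_funM; first exact/measurable_EFinP.
  by apply: measurable_funTS; exact: measurable_int RNi.
- apply/measurable_EFinP; apply: measurable_funM => //.
  by apply/measurable_EFinP; exact: measurable_int ih.
under [X in ae_eq _ _ _ X]eq_fun do rewrite EFinM.
apply: ae_eqe_mul2l.
apply: integral_ae_eq => //.
- by apply: integrableS RNi.
- exact: measurable_int ih.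
move=> A AD mA; rewrite -Radon_Nikodym_integral //.
by rewrite [LHS]nE // setIidl.
Qed.

(** On a Hahn decomposition (P, N) the Jordan parts have densities 1_P h and -1_N h, whose
    difference is h. *)
Lemma charge_integral_density (nu : {charge set U -> \bar R}) (D : set U)
    (h phi : U -> R) (M : R) : measurable D ->
  mu.-integrable D (EFin \o h) ->
  (forall A, measurable A -> A `<=` D -> nu A = (\int[mu]_(x in A) (h x)%:E)%E) ->
  measurable_fun D phi -> (forall x, `|phi x| <= M) ->
  charge_integral nu D phi = \int[mu]_(x in D) (phi x * h x).
Proof.
move=> mD ih nuE mphi phiM; rewrite /charge_integral.
(* The decomposition picked by choice is generalized to an arbitrary one. *)
set hP := cid _; set hN := cid _.
move: (svalP hN); move: (sval hP) (sval hN) => {hP hN} P N PN.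
have [[mP posP] [mN negN] PNT PN0] := PN.
have mh : measurable_fun D h by apply/measurable_EFinP; exact: measurable_int ih.
have indM (B : set U) : measurable B ->
    mu.-integrable D (EFin \o (fun x => \1_B x * h x)).
  move=> mB; apply: (@integrable_mul_bounded _ _ _ _ _ _ _ _ 1) => //.
  by move=> x; rewrite indicE; case: (_ \in _); rewrite ?normr1 ?normr0.
have intB (B A : set U) : measurable B -> measurable A -> A `<=` D ->
    (\int[mu]_(x in A) (\1_B x * h x)%:E = \int[mu]_(x in A `&` B) (h x)%:E)%E.
  move=> mB mA AD; rewrite [RHS]integral_mkcondr; apply: eq_integral => x _.
  by rewrite patchE indicE; case: (_ \in _); rewrite ?mul1r ?mul0r.
rewrite (@Rintegral_density _ D (fun x => \1_P x * h x) phi M) //; last 2 first.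
- exact: indM.
- move=> A mA AD; rewrite intB // -nuE; first last.
  + by apply: subset_trans AD; exact: subIsetl.
  + exact: measurableI.
  by apply: (etrans (jordan_posE PN A)); rewrite cjordan_posE /crestr0 mem_set.
rewrite (@Rintegral_density _ D (fun x => - (\1_N x * h x)) phi M) //; last 2 first.
- have := integrableN (indM _ mN); congr (_ .-integrable _ _).
- move=> A mA AD.
  under eq_integral do rewrite EFinN.
  rewrite integralN /=; last first.
    apply: integrable_add_def => //.
    by apply: (integrableS mD) (indM _ mN).
  rewrite intB // -nuE; first last.
  + by apply: subset_trans AD; exact: subIsetl.
  + exact: measurableI.
  by apply: (etrans (jordan_negE PN A)); rewrite cjordan_negE /crestr0 mem_set.
have iP (B : set U) : measurable B ->
    mu.-integrable D (EFin \o (fun x => phi x * (\1_B x * h x))).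
  by move=> mB; apply: (@integrable_mul_bounded _ _ _ _ _ _ _ _ M) => //; exact: indM.
rewrite -RintegralB //; last 2 first.
- exact: iP.
- rewrite (_ : (fun x => _) = (fun x => -1 * (phi x * (\1_N x * h x)))).
    by apply: integrableZ_r => //; exact: iP.
  by apply/funext => x; rewrite mulrN mulN1r.
apply: eq_Rintegral => x _; rewrite !indicE.
(* P and N partition the space, so exactly one of the two indicators equals 1. *)
have : (x \in P) (+) (x \in N).
  have [xP|xP] := boolP (x \in P) => /=.
    apply/negP; rewrite inE => xN; suff : (P `&` N) x by rewrite PN0.
    by split => //; rewrite inE in xP.
  have : (P `|` N) x by rewrite PNT.
  by case=> [/mem_set|/mem_set //]; rewrite (negbTE xP).
by case: (x \in P); case: (x \in N) => //= _; rewrite ?mul1r ?mul0r; lra.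
Qed.

Lemma cm_integral_density (F : complex_measure U R) (D : set U)
    (f g : U -> R[i]) (M : R) : measurable D ->
  has_density mu D F f ->
  measurable_fun D (fun x => complex.Re (g x)) ->
  measurable_fun D (fun x => complex.Im (g x)) ->
  (forall x, `|complex.Re (g x)| <= M) ->
  (forall x, `|complex.Im (g x)| <= M) ->
  cm_integral F D g = Cintegral mu D (fun x => g x * f x).
Proof.
move=> mD [[fr fi] Ff] mr mi gr gi.
have reE A : measurable A -> A `<=` D ->
    cm_re F A = (\int[mu]_(x in A) (complex.Re (f x))%:E)%E.
  move=> mA AD; have [h _] := Ff _ mA AD.
  rewrite -(fineK (fin_num_measure (cm_re F) _ mA)) h /Rintegral fineK //.
  by apply: integrable_fin_num => //; exact: integrableS fr.
have imE A : measurable A -> A `<=` D ->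
    cm_im F A = (\int[mu]_(x in A) (complex.Im (f x))%:E)%E.
  move=> mA AD; have [_ h] := Ff _ mA AD.
  rewrite -(fineK (fin_num_measure (cm_im F) _ mA)) h /Rintegral fineK //.
  by apply: integrable_fin_num => //; exact: integrableS fi.
have bi (p q : U -> R) : measurable_fun D p -> (forall x, `|p x| <= M) ->
    mu.-integrable D (EFin \o q) -> mu.-integrable D (EFin \o (fun x => p x * q x)).
  by move=> mp pM iq; apply: (@integrable_mul_bounded _ _ _ _ _ _ _ _ M).
rewrite /cm_integral !(charge_integral_density (M := M) mD fr reE) //.
rewrite !(charge_integral_density (M := M) mD fi imE) //.
rewrite /Cintegral; congr (_ +i* _).
- rewrite -RintegralB //; [|exact: bi|exact: bi].
  by apply: eq_Rintegral => x _; rewrite cReM.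
- rewrite -RintegralD //; [|exact: bi|exact: bi].
  by apply: eq_Rintegral => x _; rewrite cImM addrC.
Qed.

End densities.

(** * Translations and dilations of Lebesgue measure *)

Section lebesgue_affine.
Context {R : realType}.
Notation mu := (@lebesgue_measure R).

Lemma measurable_affine (a b : R) :
  measurable_fun [set: measurableTypeR R]
    ((fun x => a * x + b) : measurableTypeR R -> measurableTypeR R).
Proof. by apply: measurable_funD => //; apply: measurable_funM. Qed.

(** The right-hand side is a measure in [A]; by uniqueness of Lebesgue measure it is enough to
    compare on half-open intervals. *)
Lemma lebesgue_measure_affine (a b : R) (A : set (measurableTypeR R)) : 0 < a ->
  measurable A -> mu A = (a%:E * mu ((fun x => a * x + b)%R @^-1` A))%E.
Proof.
move=> a0 mA.
pose m : {measure set (measurableTypeR R) -> \bar R} :=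
  mscale (NngNum (ltW a0)) (measure_function_pushforward__canonical__measure_function_Measure mu (measurable_affine a b)).
apply: (@lebesgue_measure_unique R m) => // X [[x y] _ <-] /=.
rewrite /m /= /mscale /= /pushforward.
have -> : (fun z => a * z + b) @^-1` `]x, y] = `](x - b) / a, (y - b) / a]%classic.
  apply/seteqP; split => z /=; rewrite !in_itv /= ltr_pdivrMr // ler_pdivlMr // ltrBlDr lerBrDr (mulrC z) //.
rewrite !lebesgue_measure_itv /= !lte_fin ltr_pM2r ?invr_gt0 // ltrD2r.
case: ifPn => xy; last by rewrite mule0.
rewrite -!EFinD -EFinM; congr (_%:E).
by field; rewrite gt_eqF.
Qed.

(** Used with a = 1/T, since the spectral matrix at w involves the form at w/T. *)
Lemma ae_scale (a : R) (Q : R -> Prop) : 0 < a ->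
  {ae mu, forall x, Q x} -> {ae mu, forall x, Q (a * x)}.
Proof.
move=> a0 [N [mN N0 QN]]; exists ((fun x => a * x + 0) @^-1` N); split.
- by rewrite -[X in measurable X]setTI; exact: measurable_affine.
- have := lebesgue_measure_affine 0 a0 mN; rewrite N0 => /esym/eqP.
  by rewrite mule_eq0 eqe gt_eqF //= => /eqP.
- by move=> x /= nQ; apply: QN => /=; rewrite addr0.
Qed.

Lemma ge0_integral_translate (D : set R) (b : R) (f : R -> \bar R) :
  measurable D -> measurable_fun D f -> (forall x, D x -> 0 <= f x)%E ->
  (\int[mu]_(x in (fun x => x + b)%R @^-1` D) f (x + b)%R = \int[mu]_(x in D) f x)%E.
Proof.
move=> mD mf f0.
have mb : measurable_fun [set: measurableTypeR R]
    ((fun x => x + b) : measurableTypeR R -> measurableTypeR R).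
  exact: measurable_funD.
rewrite -(ge0_integral_pushforward mb) //; last by move=> x /[!inE]; exact: f0.
apply: eq_measure_integral => A mA AD.
rewrite [RHS](lebesgue_measure_affine b ltr01 mA) mul1e.
by rewrite /pushforward; congr (mu _); apply/seteqP; split => x /=; rewrite mul1r.
Qed.

Lemma integrable_translate (D : set R) (b : R) (f : R -> R) :
  measurable D -> mu.-integrable D (EFin \o f) ->
  mu.-integrable ((fun x => x + b) @^-1` D) (EFin \o (fun x => f (x + b))).
Proof.
move=> mD fi.
have mb : measurable_fun [set: measurableTypeR R]
    ((fun x => x + b) : measurableTypeR R -> measurableTypeR R).
  exact: measurable_funD.
have mf := measurable_int _ fi.
have mbD : measurable ((fun x => x + b) @^-1` D).
  by rewrite -[X in measurable X]setTI; exact: mb.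
apply/integrableP; split.
  have im : (fun x => x + b) @` ((fun x => x + b) @^-1` D) `<=` D.
    by move=> _ [x /= Dx <-].
  exact: (measurable_comp mD im mf (measurable_funTS mb)).
have /integrableP[_] := fi.
rewrite -(@ge0_integral_translate _ b (fun x => `|(f x)%:E|%E)) //.
exact: measurableT_comp.
Qed.

Lemma Rintegral_translate (D : set R) (b : R) (f : R -> R) :
  measurable D -> mu.-integrable D (EFin \o f) ->
  \int[mu]_(x in (fun x => x + b) @^-1` D) f (x + b) = \int[mu]_(x in D) f x.
Proof.
move=> mD fi; have mf := measurable_int _ fi.
rewrite /Rintegral; congr fine.
rewrite integralE [RHS]integralE.
congr (_ - _)%E.
- rewrite -[RHS](@ge0_integral_translate D b) //; last exact: measurable_funepos.
  by apply: eq_integral => x _; rewrite !funeposE.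
- rewrite -[RHS](@ge0_integral_translate D b) //; last exact: measurable_funeneg.
  by apply: eq_integral => x _; rewrite !funenegE.
Qed.

Lemma integrable_setU (A B : set R) (f : R -> \bar R) :
  measurable A -> measurable B -> [disjoint A & B] ->
  mu.-integrable A f -> mu.-integrable B f -> mu.-integrable (A `|` B) f.
Proof.
move=> mA mB AB /integrableP[mfA iA] /integrableP[mfB iB].
have mf : measurable_fun (A `|` B) f by exact/measurable_funU.
apply/integrableP; split => //.
rewrite ge0_integral_setU //; last exact: measurableT_comp.
by rewrite lte_add_pinfty.
Qed.

(** * Translation invariance of the integral over a period *)

Section periodic.
Variables (p : R) (p0 : 0 < p).
Implicit Types f : R -> R.

Lemma periodicz f : (forall x, f (x + p) = f x) ->
  forall (m : int) x, f (x + p * m%:~R) = f x.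
Proof.
move=> fp; have fn (n : nat) x : f (x + p * n%:R) = f x.
  by elim: n => [|n IH]; rewrite ?mulr0 ?addr0 // -natr1 mulrDr mulr1 addrA fp IH.
case=> n x; first exact: fn.
rewrite -[LHS](fn n.+1); congr f.
by rewrite NegzE mulrNz mulrN -addrA addNr addr0.
Qed.

(** On [0, p - s[ the point x + s stays in the period and runs over [s, p[. On [p - s, p[ it leaves
    it, and x + s - p runs over [0, s[. *)
Let periodic_shift_small f s : (forall x, f (x + p) = f x) ->
  mu.-integrable `[0, p[ (EFin \o f) -> 0 <= s < p ->
  mu.-integrable `[0, p[ (EFin \o (fun x => f (x + s))) /\
  \int[mu]_(x in `[0, p[) f (x + s) = \int[mu]_(x in `[0, p[) f x.
Proof.
move=> fp fi /andP[s0 sp].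
have D1 : (fun x => x + s) @^-1` `[s, p[ = `[0, p - s[%classic.
  by apply/seteqP; split => x /=; rewrite !in_itv /= => /andP[? ?]; apply/andP; split; lra.
have D2 : (fun x => x + (s - p)) @^-1` `[0, s[ = `[p - s, p[%classic.
  by apply/seteqP; split => x /=; rewrite !in_itv /= => /andP[? ?]; apply/andP; split; lra.
have fE x : f (x + (s - p)) = f (x + s) by rewrite -(fp (x + (s - p))); congr f; lra.
have i1 : mu.-integrable `[s, p[ (EFin \o f).
  by apply: integrableS fi => // x /=; rewrite !in_itv /= => /andP[? ?]; apply/andP; split; lra.
have i2 : mu.-integrable `[0, s[ (EFin \o f).
  by apply: integrableS fi => // x /=; rewrite !in_itv /= => /andP[? ?]; apply/andP; split; lra.
have j1 : mu.-integrable `[0, p - s[ (EFin \o (fun x => f (x + s))).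
  by rewrite -D1; exact: integrable_translate.
have j2 : mu.-integrable `[p - s, p[ (EFin \o (fun x => f (x + s))).
  rewrite (_ : (fun x => f (x + s)) = (fun x => f (x + (s - p)))).
    by rewrite -D2; exact: integrable_translate.
  by apply/funext => x; rewrite fE.
have U1 : `[0, p[%classic = `[0, p - s[ `|` `[p - s, p[.
  apply/seteqP; split => x /=; rewrite !in_itv /=.
    by move=> /andP[? ?]; have [?|?] := ltP x (p - s); [left|right]; apply/andP; split; lra.
  by move=> [/andP[? ?]|/andP[? ?]]; apply/andP; split; lra.
have U2 : `[0, p[%classic = `[0, s[ `|` `[s, p[.
  apply/seteqP; split => x /=; rewrite !in_itv /=.
    by move=> /andP[? ?]; have [?|?] := ltP x s; [left|right]; apply/andP; split; lra.
  by move=> [/andP[? ?]|/andP[? ?]]; apply/andP; split; lra.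
have d1 : [disjoint `[0, p - s[%classic & `[p - s, p[%classic].
  by apply/disj_setPS => x [/=]; rewrite !in_itv /= => /andP[? ?] /andP[? ?]; lra.
have d2 : [disjoint `[0, s[%classic & `[s, p[%classic].
  by apply/disj_setPS => x [/=]; rewrite !in_itv /= => /andP[? ?] /andP[? ?]; lra.
have ii : mu.-integrable `[0, p[ (EFin \o (fun x => f (x + s))).
  by rewrite U1; apply: integrable_setU.
split=> //.
rewrite [in LHS]U1 Rintegral_setU -?U1 // [in RHS]U2 Rintegral_setU -?U2 //.
rewrite addrC; congr (_ + _); last by rewrite -D1 Rintegral_translate.
rewrite -(@Rintegral_translate `[0, s[%classic (s - p)) // D2.
by apply: eq_Rintegral => x _; rewrite fE.
Qed.

Lemma periodic_shift f s : (forall x, f (x + p) = f x) ->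
  mu.-integrable `[0, p[ (EFin \o f) ->
  mu.-integrable `[0, p[ (EFin \o (fun x => f (x + s))) /\
  \int[mu]_(x in `[0, p[) f (x + s) = \int[mu]_(x in `[0, p[) f x.
Proof.
move=> fp fi; pose m := Num.floor (s / p); pose t := s - p * m%:~R.
have tp : 0 <= t < p.
  have : m%:~R <= s / p by exact: floor_le.
  have : s / p < (m + 1)%:~R by exact: floorD1_gt.
  by rewrite ler_pdivlMr // ltr_pdivrMr // intrD /t; lra.
have E : (fun x => f (x + s)) = (fun x => f (x + t)).
  by apply/funext => x; rewrite -[RHS](periodicz fp m); congr f; rewrite /t; lra.
rewrite E; have [i1 i2] := periodic_shift_small fp fi tp; split => //.
Qed.

End periodic.

End lebesgue_affine.

(** * Pointwise positivity from integrals over short intervals *)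

Section positivity.
Context {R : realType}.
Notation mu := (@lebesgue_measure R).

(** Almost every value of h is a limit of its averages over shrinking balls. The bound [d0] is there
    because positivity is available only on arcs short enough to have disjoint translates. *)
Lemma ae_ge0_of_small_intervals (p d0 : R) (h : R -> R) : 0 < d0 ->
  mu.-integrable `[0, p[ (EFin \o h) ->
  (forall x r, 0 < r -> r <= d0 -> 0 <= x - r -> x + r <= p ->
     0 <= \int[mu]_(y in `]x - r, x + r[) h y) ->
  {ae mu, forall x, x \in `[0, p[ -> 0 <= h x}.
Proof.
move=> d00 hi h0; pose g := h \_ `[0, p[.
have gi : mu.-integrable setT (EFin \o g).
  rewrite /g -restrict_EFin.
  have [H _] := @integrable_mkcond _ _ _ mu _ (EFin \o h) (measurable_itv `[0, p[).
  exact: H.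
have locg : locally_integrable setT g by apply: open_integrable_locally gi; exact: openT.
(* No ball about 0 lies in [[0, p[], so this point is discarded. *)
have ae0 : {ae mu, forall x : R, x != 0}.
  exists [set 0]; split; [exact: measurable_set1|exact: lebesgue_measure_set1|].
  by move=> x /= /negP; rewrite negbK => /eqP.
move: (lebesgue_differentiation locg) ae0; apply: filterS2.
  exact: (ae_filter_ringOfSetsType mu).
move=> x xg x0 xD.
have [xge0 xp] : 0 <= x /\ x < p by move: xD; rewrite in_itv /= => /andP.
have xgt0 : 0 < x by rewrite lt_neqAle eq_sym x0.
(* The largest radius allowed by [d0] for which the open ball about x stays in the period. *)
pose r0 := Num.min d0 (Num.min x (p - x)).
have r00 : 0 < r0 by rewrite !lt_min d00 xgt0 subr_gt0.
pose r (n : nat) : R := r0 / n.+1%:R.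
have rp n : 0 < r n by rewrite divr_gt0.
have rr0 n : r n <= r0.
  by rewrite ler_pdivrMr // ler_peMr ?(ltW r00) // ler1n.
pose E (y : R) (n : nat) := ball y (r n).
have hE y : nicely_shrinking y (E y).
  split; first by move=> n; exact: measurable_ball.
  exists (1, fun n => PosNum (rp n)); split => //=.
  - rewrite -(mulr0 r0); apply: cvgM; first exact: cvg_cst.
    exact: cvg_harmonic.
  - by move=> n; exact: subset_refl.
  - by move=> n; rewrite mul1e.
have := nice_lebesgue_differentiation hE locg xg => cvgx.
have : (0 <= (g x)%:E)%E.
  rewrite -(cvg_lim _ cvgx) //; apply: lime_ge; first by apply/cvg_ex; eexists; exact: cvgx.
  apply: nearW => n; apply: mule_ge0; first by rewrite inve_ge0.
  have sub : E x n `<=` `[0, p[.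
    rewrite /E ball_itv => y /=; rewrite !in_itv /=.
    have := rr0 n; rewrite /r0 !le_min => /and3P[_ ? ?] /andP[? ?].
    by apply/andP; split; lra.
  have iE : mu.-integrable (E x n) (EFin \o h).
    by apply: integrableS hi => //; exact: measurable_ball.
  have -> : (\int[mu]_(y in E x n) (g y)%:E = \int[mu]_(y in E x n) (h y)%:E)%E.
    apply: eq_integral => y /[!inE] yE; rewrite /g patchE mem_set //.
    exact: sub.
  rewrite -(fineK (integrable_fin_num _ iE)) ?lee_fin; last exact: measurable_ball.
  rewrite /E ball_itv; apply: h0 => //.
  + by apply: le_trans (rr0 n) _; rewrite ge_min lexx.
  + by have := rr0 n; rewrite /r0 !le_min => /and3P[_ ? ?]; lra.
  + by have := rr0 n; rewrite /r0 !le_min => /and3P[_ ? ?]; lra.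
by rewrite lee_fin /g patchE mem_set.
Qed.

End positivity.

(** * Trigonometric polynomials approximating arcs *)

Section trigonometric_polynomials.
Context {R : realType}.
Implicit Types (p q : R -> R[i]).

(** Frequencies may repeat in [s], so sums are concatenations and products are lists of pairs, with
    no collecting of terms. *)
Definition trigpoly p := exists s : seq (R[i] * int),
  forall x, p x = \sum_(a <- s) a.1 * expi (a.2%:~R * x).

Lemma trigpoly_cst (c : R[i]) : trigpoly (fun=> c).
Proof.
by exists [:: (c, 0)] => x; rewrite big_seq1 /= mul0r expi0 mulr1.
Qed.

Lemma trigpolyD p q : trigpoly p -> trigpoly q -> trigpoly (fun x => p x + q x).
Proof. by move=> [s ps] [t qt]; exists (s ++ t) => x; rewrite big_cat ps qt. Qed.

Lemma trigpolyM p q : trigpoly p -> trigpoly q -> trigpoly (fun x => p x * q x).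
Proof.
move=> [s ps] [t qt].
exists [seq (a.1 * b.1, a.2 + b.2) | a <- s, b <- t] => x.
rewrite big_allpairs_dep ps qt mulr_suml; apply: eq_bigr => a _.
rewrite mulr_sumr; apply: eq_bigr => b _ /=.
by rewrite intrD mulrDl expiD mulrACA.
Qed.

Lemma trigpolyX p n : trigpoly p -> trigpoly (fun x => p x ^+ n).
Proof.
move=> pp; elim: n => [|n IH].
  by under eq_fun do rewrite expr0; exact: trigpoly_cst.
by under eq_fun do rewrite exprS; exact: trigpolyM.
Qed.

Lemma trigpoly_sum (I : Type) (r : seq I) (F : I -> R -> R[i]) :
  (forall i, trigpoly (F i)) -> trigpoly (fun x => \sum_(i <- r) F i x).
Proof.
move=> FP; elim: r => [|i r IH].
  by under eq_fun do rewrite big_nil; exact: trigpoly_cst.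
by under eq_fun do rewrite big_cons; exact: trigpolyD.
Qed.

Lemma trigpoly_cos (c : R) : trigpoly (fun x => (cos (x - c))%:C).
Proof.
exists [:: ((2^-1)%:C * expi (- c), 1%:Z); ((2^-1)%:C * expi c, - 1%:Z)] => x.
rewrite big_cons big_seq1 /= mul1r mulN1r -!mulrA -!expiD -mulrDr.
apply: eq_complexP; rewrite !(cReM, cImM, cReD, cImD) /=.
  by rewrite -(cosN (c + - x)) opprD opprK (addrC (- c)); lra.
by rewrite -(opprK (c + - x)) sinN opprD opprK (addrC (- c)); lra.
Qed.

End trigonometric_polynomials.

Section bumps.
Context {R : realType}.

Lemma bernoulli_ge (y : R) m : -1 <= y -> 1 + m%:R * y <= (1 + y) ^+ m.
Proof.
move=> y1; elim: m => [|m IH]; first by rewrite mul0r addr0.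
rewrite exprS -natr1.
apply: le_trans (_ : (1 + y) * (1 + m%:R * y) <= _).
  by have := sqr_ge0 y; have : 0 <= m%:R :> R by []; nra.
by apply: ler_wpM2l => //; lra.
Qed.

(* The power functions of the elementary proof of the Stone-Weierstrass
   theorem by Brosowski and Deutsch. *)
Definition bd_step (n : nat) (t : R) : R := (1 - t ^+ n) ^+ (2 ^ n).

Lemma bd_step_bound n t : 0 <= t <= 1 -> 0 <= bd_step n t <= 1.
Proof.
move=> /andP[t0 t1]; have tn : 0 <= t ^+ n <= 1 by rewrite exprn_ge0 // exprn_ile1.
by rewrite exprn_ge0 ?exprn_ile1 //; lra.
Qed.

(** Bernoulli's inequality gives 1 - (2t)^n <= (1 - t^n)^(2^n) <= 1. *)
Lemma bd_step_cvg1 t : 0 <= t -> t < 2^-1 -> bd_step n t @[n --> \oo] --> (1 : R).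
Proof.
move=> t0 t2; have t1 : t <= 1 by lra.
apply: (@squeeze_cvgr _ _ _ _ (fun n => 1 - (2 * t) ^+ n) (cst 1)).
- apply: nearW => n; have tn : 0 <= t ^+ n <= 1 by rewrite exprn_ge0 // exprn_ile1.
  have /andP[_ ->] := @bd_step_bound n t (andb_true_intro (conj t0 t1)).
  rewrite andbT /bd_step; have := @bernoulli_ge (- t ^+ n) (2 ^ n).
  by rewrite natrX mulrN -exprMn; apply; lra.
- rewrite -[X in _ --> X]subr0; apply: cvgB; first exact: cvg_cst.
  by apply: cvg_expr; rewrite ger0_norm; lra.
- exact: cvg_cst.
Qed.

(** Multiplying by (1 + t^n)^(2^n) yields (1 - t^(2n))^(2^n) <= 1, while Bernoulli bounds that
    factor below by (2t)^n; so the value is at most (2t)^(-n). *)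
Lemma bd_step_cvg0 t : 2^-1 < t -> t <= 1 -> bd_step n t @[n --> \oo] --> (0 : R).
Proof.
move=> t2 t1; have t0 : 0 < t by lra.
apply: (@squeeze_cvgr _ _ _ _ (cst 0) (fun n => ((2 * t)^-1) ^+ n)).
- apply: nearW => n; have tn : 0 < t ^+ n <= 1 by rewrite exprn_gt0 // exprn_ile1 // ltW.
  have /andP[-> _] := @bd_step_bound n t (andb_true_intro (conj (ltW t0) t1)).
  have u0 : 0 < (2 * t) ^+ n by rewrite exprn_gt0 //; lra.
  rewrite /= exprVn -[_^-1]mul1r ler_pdivlMr //.
  have b1 : (2 * t) ^+ n <= (1 + t ^+ n) ^+ (2 ^ n).
    have tn1 : -1 <= t ^+ n by lra.
    by have := bernoulli_ge (2 ^ n) tn1; rewrite natrX -exprMn; lra.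
  have s0 : 0 <= bd_step n t by rewrite exprn_ge0 //; lra.
  apply: le_trans (ler_wpM2l s0 b1) _; rewrite /bd_step -exprMn.
  by apply: exprn_ile1; nra.
- exact: cvg_cst.
- by apply: cvg_expr; rewrite gtr0_norm ?invr_gt0 ?invf_lt1; lra.
Qed.

(** Written with constants, sums, products and powers only, to match the closure lemmas of
    [trigpoly]. *)
Lemma bd_step_complex (a b t : R) n : (bd_step n (a + b * t))%:C =
  (1 + (-1) * (a%:C + b%:C * t%:C) ^+ n) ^+ (2 ^ n).
Proof.
by rewrite /bd_step rmorphXn rmorphB rmorph1 rmorphXn rmorphD rmorphM mulN1r.
Qed.

Variable delta : R.

(** The affine map puts the argument in [0, 1] and sends the boundary [cos (x - c) = cos delta] to
    1/2, the threshold of [bd_step]; the inside of the arc goes below 1/2. *)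
Definition cos_bump (c : R) (n : nat) (x : R) : R :=
  bd_step n ((2 + cos delta - cos (x - c)) / 4).

(** For 0 < delta <= pi, the union of the 2 pi-translates of ]c - delta, c + delta[; the cosine
    builds the periodicity in. *)
Definition cos_arc (c : R) : set R := [set x | cos delta < cos (x - c)].

Let cos_bump_arg c x : 0 <= (2 + cos delta - cos (x - c)) / 4 <= 1.
Proof.
have := cos_le1 delta; have := cos_geN1 delta.
by have := cos_le1 (x - c); have := cos_geN1 (x - c); lra.
Qed.

Lemma cos_bump_bound c n x : `|cos_bump c n x| <= 1.
Proof.
have /andP[b0 b1] := bd_step_bound n (cos_bump_arg c x).
by rewrite ger0_norm.
Qed.

Lemma cos_bump_trigpoly c n : trigpoly (fun x => (cos_bump c n x)%:C).
Proof.
have h (x : R) : (cos_bump c n x)%:C =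
   (1 + (-1) * (((2 + cos delta) / 4)%:C + (- 4^-1)%:C * (cos (x - c))%:C) ^+ n) ^+ (2 ^ n).
  have e : (2 + cos delta - cos (x - c)) / 4 =
      (2 + cos delta) / 4 + (- 4^-1) * cos (x - c) by lra.
  by rewrite /cos_bump e bd_step_complex.
under eq_fun do rewrite h.
apply: trigpolyX; apply: trigpolyD; first exact: trigpoly_cst.
apply: trigpolyM; first exact: trigpoly_cst.
apply: trigpolyX; apply: trigpolyD; first exact: trigpoly_cst.
apply: trigpolyM; first exact: trigpoly_cst.
exact: trigpoly_cos.
Qed.

Lemma continuous_cos_shift (c : R) : continuous (fun x : R => cos (x - c)).
Proof.
move=> x; apply: (continuous_comp (f := fun x => x - c) (g := @cos R)).
  by apply: cvgB; [exact: cvg_id|exact: cvg_cst].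
exact: continuous_cos.
Qed.

Lemma measurable_cos_shift (c : R) (D : set R) :
  measurable_fun D (fun x : R => cos (x - c)).
Proof.
apply: measurable_funTS; apply: continuous_measurable_fun.
exact: continuous_cos_shift.
Qed.

Lemma measurable_cos_bump c n (D : set R) : measurable_fun D (cos_bump c n).
Proof.
apply: measurable_funX; apply: measurable_funB => //; apply: measurable_funX.
apply: measurable_funM => //; apply: measurable_funB => //.
exact: measurable_cos_shift.
Qed.

Lemma measurable_cos_arc c : measurable (cos_arc c).
Proof.
have := @measurable_cos_shift c setT measurableT `]cos delta, +oo[%classic.
rewrite setTI (_ : _ @^-1` _ = cos_arc c); first by apply.
by apply/seteqP; split => x /=; rewrite in_itv /= andbT.
Qed.

Lemma cos_bump_cvg c x : cos (x - c) <> cos delta ->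
  cos_bump c n x @[n --> \oo] --> (\1_(cos_arc c) x : R).
Proof.
move=> ne; have /andP[b0 b1] := cos_bump_arg c x.
rewrite indicE; case: (ltgtP (cos delta) (cos (x - c))) => [lt|gt|/esym //].
- by rewrite mem_set //; apply: bd_step_cvg1 => //; lra.
- rewrite memNset; last by rewrite /cos_arc /= ltNge ltW.
  by apply: bd_step_cvg0 => //; lra.
Qed.

(** A zero of the sine satisfies [expi (u + u) = 1], so [expi_eq1] applies to 2u. *)
Lemma sin0_int (u : R) : sin u = 0 -> exists m : int, u = pi * m%:~R.
Proof.
move=> su; have : expi (u + u) = 1.
  by rewrite /expi cosD sinD su; have := cos2Dsin2 u; rewrite su => h; congr (_ +i* _); nra.
by move=> /expi_eq1[m um]; exists m; lra.
Qed.

(** With x - c = v + u and delta = v - u, the difference of the cosines is -2 sin u sin v; hence x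
    is one of the countably many c + delta + 2 pi m, c - delta + 2 pi m. *)
Lemma cos_arc_boundary_null c :
  (@lebesgue_measure R).-negligible [set x | cos (x - c) = cos delta].
Proof.
pose g (bm : bool * int) : R := c + (-1) ^+ bm.1 * delta + 2 * pi * bm.2%:~R.
have cg : countable (range g).
  by apply: sub_countable (countableP setT); exact: card_image_le.
exists (range g); split; [exact: countable_measurable|exact: countable_lebesgue_measure0|].
move=> x /= h; pose u := (x - c - delta) / 2; pose v := (x - c + delta) / 2.
have : sin u * sin v = 0.
  have E1 : x - c = v + u by rewrite /u /v; lra.
  have E2 : delta = v - u by rewrite /u /v; lra.
  by move: h; rewrite {1}E1 {1}E2 cosD cosB; lra.
move=> /eqP; rewrite mulf_eq0 => /orP[]/eqP/sin0_int[m].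
- by rewrite /u => E; exists (false, m) => //; rewrite /g /= expr0; lra.
- by rewrite /v => E; exists (true, m) => //; rewrite /g /= expr1; lra.
Qed.

End bumps.

Section cos_bump_integrals.
Context {R : realType}.
Notation mu := (@lebesgue_measure R).
Variables (delta : R) (D : set R) (mD : measurable D).

(** The bumps are bounded by 1, so |h| dominates; pointwise convergence can fail only on the two
    null boundaries. *)
Lemma Rintegral_bump_cvg (c c' : R) (h : R -> R) :
  mu.-integrable D (EFin \o h) ->
  \int[mu]_(x in D) (cos_bump delta c n x * cos_bump delta c' n x * h x) @[n --> \oo]
    --> \int[mu]_(x in D) (\1_(cos_arc delta c) x * \1_(cos_arc delta c') x * h x).
Proof.
move=> hi; have mh : measurable_fun D h by apply/measurable_EFinP; exact: measurable_int hi.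
pose F (n : nat) (x : R) := (cos_bump delta c n x * cos_bump delta c' n x * h x)%:E.
pose L (x : R) := (\1_(cos_arc delta c) x * \1_(cos_arc delta c') x * h x)%:E.
have mL : measurable_fun D L.
  apply/measurable_EFinP; apply: measurable_funM => //.
  by apply: measurable_funM; apply: measurable_indic; exact: measurable_cos_arc.
have mF n : measurable_fun D (F n).
  apply/measurable_EFinP; apply: measurable_funM => //.
  by apply: measurable_funM; exact: measurable_cos_bump.
have Fh : {ae mu, forall x n, D x -> (`|F n x| <= `|(EFin \o h) x|)%E}.
  apply: aeW => x n _; rewrite /F /= lee_fin !normrM -[leRHS]mul1r.
  apply: ler_wpM2r => //.
  by rewrite -[leRHS]mulr1; apply: ler_pM => //; exact: cos_bump_bound.
have DC := fun FL => @dominated_convergence _ _ R mu D mD F L _ mF mL FL (integrable_abse hi) Fh.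
have {DC}[|iL _] := DC.
  have n1 := cos_arc_boundary_null delta c; have n2 := cos_arc_boundary_null delta c'.
  apply: negligibleS (negligibleU n1 n2) => x /= nc.
  apply: contrapT => /not_orP[x1 x2]; apply: nc => _.
  apply: cvg_EFin; first exact: nearW.
  by apply: cvgM; [apply: cvgM; exact: cos_bump_cvg|exact: cvg_cst].
have Lfin : (\int[mu]_(x in D) L x)%E \is a fin_num by exact: integrable_fin_num.
by rewrite -(fineK Lfin) => /fine_cvg.
Qed.

Lemma Cintegral_bump_cvg (c c' : R) (f : R -> R[i]) : Cintegrable mu D f ->
  Ccvg (fun n => Cintegral mu D (fun x =>
          (cos_bump delta c n x * cos_bump delta c' n x)%:C * f x))
       (Cintegral mu D (fun x =>
          (\1_(cos_arc delta c) x * \1_(cos_arc delta c') x)%:C * f x)).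
Proof.
move=> [fr fi]; split.
- rewrite (_ : (fun n => _) = (fun n => \int[mu]_(x in D)
      (cos_bump delta c n x * cos_bump delta c' n x * complex.Re (f x)))); last first.
    by apply/funext => n; apply: eq_Rintegral => x _; rewrite cReM /= mul0r subr0.
  rewrite [X in _ --> X](_ : _ = \int[mu]_(x in D)
      (\1_(cos_arc delta c) x * \1_(cos_arc delta c') x * complex.Re (f x))).
    exact: Rintegral_bump_cvg.
  by apply: eq_Rintegral => x _; rewrite cReM /= mul0r subr0.
- rewrite (_ : (fun n => _) = (fun n => \int[mu]_(x in D)
      (cos_bump delta c n x * cos_bump delta c' n x * complex.Im (f x)))); last first.
    by apply/funext => n; apply: eq_Rintegral => x _; rewrite cImM /= mul0r addr0.
  rewrite [X in _ --> X](_ : _ = \int[mu]_(x in D)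
      (\1_(cos_arc delta c) x * \1_(cos_arc delta c') x * complex.Im (f x))).
    exact: Rintegral_bump_cvg.
  by apply: eq_Rintegral => x _; rewrite cImM /= mul0r addr0.
Qed.

End cos_bump_integrals.

(** * Arcs: disjointness of translates, comparison with intervals *)

Section arcs.
Context {R : realType}.
Implicit Types (delta c x : R).

Lemma cos_arc2pi delta c x (m : int) :
  (cos_arc delta c (x + 2 * pi * m%:~R)) = cos_arc delta c x.
Proof.
rewrite /cos_arc /=; congr (is_true (_ < _)).
rewrite -addrA addrCA addrC.
have := @periodicz R (2 * pi) cos; apply => y.
by rewrite mulr_natl cosD2pi.
Qed.

(** |cos| has period pi, so m may be replaced by its residue r. As 1 <= r <= T - 1, the angle lies
    between pi/T and pi - pi/T, where |cos| is at most cos(pi/T). *)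
Lemma norm_cos_le (T : nat) (m : int) : (0 < T)%N -> ~~ (T %| m)%Z ->
  `|cos (pi * m%:~R / T%:R)| <= cos (pi / T%:R : R).
Proof.
move=> T0 Tm; have TR : 0 < T%:R :> R by rewrite ltr0n.
have pi0 := @pi_gt0 R.
have mE := divz_eq m T; have r0 := @modz_ge0 m T; have rT := @ltz_pmod m T.
set q := divz m T in mE; set r := modz m T in mE r0 rT.
have r1 : (1 <= r)%R.
  have : r <> 0 by move=> e; move/negP: Tm; apply; apply/dvdzP; exists q; lia.
  by lia.
have rT' : (r <= T%:Z - 1)%R by lia.
have -> : pi * m%:~R / T%:R = pi * r%:~R / T%:R + pi * q%:~R :> R.
  by rewrite mE intrD intrM -pmulrn; field; rewrite gt_eqF.
rewrite (@periodicz R pi (fun x => `|cos x|)); last first.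
  by move=> x; rewrite cosDpi normrN.
have r1R : 1 <= r%:~R :> R by rewrite -[1]/(1%:~R) ler_int.
have rTR : r%:~R <= T%:R - 1 :> R.
  by rewrite -[1 in leRHS]/(1%:~R) pmulrn -intrB ler_int.
have a0 : 0 < pi / T%:R :> R by rewrite divr_gt0.
have aE : pi * r%:~R / T%:R = pi / T%:R * r%:~R :> R by rewrite mulrAC.
have aT : pi / T%:R * T%:R = pi :> R by rewrite divfK // gt_eqF.
have lo : pi / T%:R <= pi * r%:~R / T%:R :> R by rewrite aE; nra.
have hi : pi * r%:~R / T%:R <= pi - pi / T%:R :> R by rewrite aE; nra.
have cos_anti (x y : R) : 0 <= x -> x <= y -> y <= pi -> cos y <= cos x.
  move=> x0 xy yp; move: xy; rewrite le_eqVlt => /orP[/eqP-> //|xy].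
  by apply: ltW; rewrite ltr_cos // in_itv /=; apply/andP; split; lra.
rewrite ler_norml; apply/andP; split; last by apply: cos_anti; lra.
have -> : - cos (pi / T%:R) = cos (pi - pi / T%:R) :> R.
  by rewrite cosB cospi sinpi; lra.
by apply: cos_anti; lra.
Qed.

(** With y = pi m/T and z = x - c - y, both memberships add up to 2 cos z cos y > 2 cos delta >= 2
    cos(pi/T), against [norm_cos_le] when T does not divide m. *)
Lemma cos_arc_translates_disjoint (T : nat) delta c x (m : int) : (0 < T)%N ->
  0 < delta <= pi / T%:R ->
  cos_arc delta c x -> cos_arc delta c (x - 2 * pi * m%:~R / T%:R) -> (T %| m)%Z.
Proof.
move=> T0 /andP[d0 dT] a1 a2; apply/negPn/negP => Tm.
have := norm_cos_le T0 Tm; move: a1 a2; rewrite /cos_arc /=.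
set y := (pi * m%:~R / T%:R : R).
have TR : 1 <= T%:R :> R by rewrite ler1n.
have pi0 := @pi_gt0 R.
have piT : pi / T%:R <= pi :> R by rewrite ler_pdivrMr ?ler_peMr // ?ltW //; lra.
have cd : cos (pi / T%:R) <= cos delta :> R.
  move: dT; rewrite le_eqVlt => /orP[/eqP-> //|dT].
  by apply: ltW; rewrite ltr_cos // in_itv /=; apply/andP; split; lra.
pose z := x - c - y.
have E1 : x - c = z + y by rewrite /z; lra.
have E2 : x - 2 * pi * m%:~R / T%:R - c = z - y by rewrite /z /y; lra.
rewrite {}E2 {}E1 cosB cosD => h1 h2 h3.
have := ler_norm (cos z * cos y); rewrite normrM.
have := ler_piMl (normr_ge0 (cos y)) (cos_max z); lra.
Qed.

(** The interval lies in the period, so |x - c| <= 2 pi - delta. If |x - c| >= delta, then this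
    distance, or its reflection 2 pi - |x - c| when it exceeds pi, lies in [delta, pi], where the
    cosine is at most cos delta. *)
Lemma cos_arc_itv delta c x : 0 < delta <= pi -> 0 <= c - delta -> c + delta <= 2 * pi ->
  x \in `[0, 2 * pi[ -> cos_arc delta c x <-> x \in `]c - delta, c + delta[.
Proof.
move=> /andP[d0 dp] c0 c2; rewrite !in_itv /= => /andP[x0 x2].
have pi0 := @pi_gt0 R.
rewrite /cos_arc /= -(cos_norm (x - c)).
have zE : (c - delta < x < c + delta) = (`|x - c| < delta).
  by rewrite ltr_distl.
rewrite zE; have z0 := normr_ge0 (x - c).
have z2 : `|x - c| <= 2 * pi - delta by rewrite ler_norml; apply/andP; split; lra.
move: z0 z2; move: `|x - c| => z z0 z2; split=> h.
- rewrite ltNge; apply/negP => dz.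
  have [zp|pz] := leP z pi.
    move: dz; rewrite le_eqVlt => /orP[/eqP dz|dz]; first by rewrite dz ltxx in h.
    have : cos z < cos delta by rewrite ltr_cos // in_itv /=; apply/andP; split; lra.
    lra.
  have cz : cos z = cos (2 * pi - z).
    by rewrite -(cosN (2 * pi - z)) opprB -[in LHS](subrK (2 * pi) z) mulr_natl cosD2pi.
  rewrite cz in h.
  have : delta <= 2 * pi - z by lra.
  rewrite le_eqVlt => /orP[/eqP dz'|dz']; first by rewrite -dz' ltxx in h.
  have : cos (2 * pi - z) < cos delta by rewrite ltr_cos // in_itv /=; apply/andP; split; lra.
  lra.
- by rewrite ltr_cos // in_itv /=; apply/andP; split; lra.
Qed.

End arcs.

(** * Positivity of the spectral form *)

Lemma measurable_expi {R : realType} (m : R) (D : set R) :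
  measurable_fun D (fun w => complex.Re (expi (m * w))) /\
  measurable_fun D (fun w => complex.Im (expi (m * w))).
Proof.
split; apply: measurable_funTS; apply: continuous_measurable_fun => x.
- apply: (continuous_comp (f := fun w => m * w) (g := @cos R)).
    by apply: cvgM; [exact: cvg_cst|exact: cvg_id].
  exact: continuous_cos.
- apply: (continuous_comp (f := fun w => m * w) (g := @sin R)).
    by apply: cvgM; [exact: cvg_cst|exact: cvg_id].
  exact: continuous_sin.
Qed.

Lemma Cintegral_shift {R : realType} (p : R) (f : R -> R[i]) (s : R) : 0 < p ->
  (forall x, f (x + p) = f x) ->
  Cintegrable (@lebesgue_measure R) `[0, p[ f ->
  Cintegrable (@lebesgue_measure R) `[0, p[ (fun x => f (x + s)) /\
  Cintegral (@lebesgue_measure R) `[0, p[ (fun x => f (x + s)) =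
  Cintegral (@lebesgue_measure R) `[0, p[ f.
Proof.
move=> p0 fp [fr fi].
have [|i1 e1] := @periodic_shift R p p0 (fun x => complex.Re (f x)) s _ fr.
  by move=> x; rewrite fp.
have [|i2 e2] := @periodic_shift R p p0 (fun x => complex.Im (f x)) s _ fi.
  by move=> x; rewrite fp.
by split; [split | rewrite /Cintegral e1 e2].
Qed.

Section positive_spectral_form.
Context {R : realType}.
Notation mu := (@lebesgue_measure R).
Variables (T : nat) (T0 : (0 < T)%N).
Variables (rho : int -> int -> R[i]) (f : int -> R -> R[i]).
Let D : set R := `[0, 2 * pi[%classic.
Definition theta (j : int) : R := 2 * pi * j%:~R / T%:R.

Hypothesis f_integrable : forall k : 'I_T, Cintegrable mu D (f k).
Hypothesis f_period : forall k w, f (k + T%:Z) w = f k w.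
Hypothesis f_2pi : forall k w, f k (w + 2 * pi) = f k w.
Hypothesis rhoE : forall n tau : int, rho n tau =
  \sum_(k < T) Cintegral mu D (fun w => expi (tau%:~R * w) * f k w) *
               expi (2 * k%:R * pi * n%:~R / T%:R).
Hypothesis rho_nonneg : forall s : seq (R[i] * int),
  0 <= \sum_(a <- s) \sum_(b <- s) a.1 * (b.1)^* * rho b.2 (a.2 - b.2).

Let mD : measurable D. Proof. exact: measurable_itv. Qed.
Let pi2 : 0 < 2 * pi :> R. Proof. by rewrite mulr_gt0 // pi_gt0. Qed.
Let TR : 0 < T%:R :> R. Proof. by rewrite ltr0n. Qed.

Lemma spectral_periodz (k q : int) : f (k + q * T%:Z) = f k.
Proof.
have fn (n : nat) (l : int) : f (l + n%:Z * T%:Z) = f l.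
  elim: n => [|n IH]; first by rewrite mul0r addr0.
  by rewrite -[n.+1]addn1 PoszD mulrDl mul1r addrA; apply/funext => w; rewrite f_period IH.
case: q => n; first exact: fn.
by rewrite -[LHS](fn n.+1) NegzE mulNr -addrA addNr addr0.
Qed.

Lemma spectral_integrable (k : int) : Cintegrable mu D (f k).
Proof.
have kE := divz_eq k T; have k0 := @modz_ge0 k T; have kT := @ltz_pmod k T.
have lt : (absz (modz k T) < T)%N by lia.
have -> : f k = f (Ordinal lt).
  rewrite [in LHS]kE addrC spectral_periodz; congr f => /=.
  by rewrite gez0_abs //; apply: k0; lia.
exact: f_integrable.
Qed.

Let expi_integrable (m : R) (k : int) :
  Cintegrable mu D (fun w => expi (m * w) * f k w).
Proof.
have [mr mi] := measurable_expi m D.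
apply: (@Cintegrable_mul_bounded _ _ _ mu D mD _ _ 1) => //.
- by move=> x; exact: cos_max.
- by move=> x; exact: sin_max.
- exact: spectral_integrable.
Qed.

(** Expanding p over its terms (c_a, m_a) turns the form into the double sum of c_a conj(c_b) [rho]
    m_b (m_a - m_b), with the phase of [rhoE] absorbed in the shift by [theta k]. *)
Lemma trigpoly_form_ge0 (p : R -> R[i]) : trigpoly p ->
  0 <= \sum_(k < T) Cintegral mu D (fun x => p x * (p (x - theta k))^* * f k x).
Proof.
move=> [s ps].
pose F (a b : R[i] * int) (k : 'I_T) (x : R) := a.1 * (b.1)^* *
  expi (2 * k%:R * pi * b.2%:~R / T%:R) * (expi ((a.2 - b.2)%:~R * x) * f k x).
have iF a b k : Cintegrable mu D (F a b k).
  by apply: CintegrableZ => //; exact: expi_integrable.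
rewrite (_ : \sum_(k < T) _ =
    \sum_(a <- s) \sum_(b <- s) a.1 * (b.1)^* * rho b.2 (a.2 - b.2)) //.
under [RHS]eq_bigr do under eq_bigr do rewrite rhoE mulr_sumr.
under [RHS]eq_bigr do rewrite exchange_big.
rewrite [RHS]exchange_big /=; apply: eq_bigr => k _.
rewrite (_ : (fun x => _) = (fun x => \sum_(a <- s) \sum_(b <- s) F a b k x)).
  rewrite Cintegral_sum //; last by move=> a; exact: Cintegrable_sum.
  apply: eq_bigr => a _; rewrite Cintegral_sum //; apply: eq_bigr => b _.
  by rewrite CintegralZ // mulrA mulrAC.
apply/funext => x; rewrite !ps rmorph_sum !mulr_suml; apply: eq_bigr => a _.
rewrite mulr_sumr mulr_suml; apply: eq_bigr => b _.
rewrite rmorphM /= -expiN /F [RHS]mulrA; congr (_ * _).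
rewrite mulrACA -expiD -[RHS]mulrA -expiD; congr (_ * expi _).
rewrite /theta intrB -pmulrn.
move: (a.2%:~R : R) (b.2%:~R : R) (nat_of_ord k)%:R (T%:R^-1) => A B K t; ring.
Qed.

(** T times the quadratic form of the spectral density matrix at frequency T x. *)
Definition spectral_form (u : 'I_T -> R[i]) (x : R) : R[i] :=
  \sum_(j < T) \sum_(l < T) u j * (u l)^* * f (l%:Z - j%:Z) (x - theta j).

Let arc_bump_integrable (A B : R -> R) k : measurable_fun D A -> measurable_fun D B ->
  (forall x, `|A x| <= 1) -> (forall x, `|B x| <= 1) ->
  Cintegrable mu D (fun x => (A x * B x)%:C * f k x).
Proof.
move=> mA mB A1 B1.
apply: (@Cintegrable_mul_bounded _ _ _ mu D mD _ _ 1) => /=.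
- exact: measurable_funM.
- exact: measurable_cst.
- by move=> x; rewrite normrM -[leRHS]mulr1; exact: ler_pM.
- by move=> x; rewrite normr0.
- exact: spectral_integrable.
Qed.

Let indic_le1 (A : set R) (x : R) : `|\1_A x| <= 1 :> R.
Proof. by rewrite indicE; case: (_ \in _); rewrite ?normr1 ?normr0. Qed.

Let shifted_term (j : 'I_T) (k : int) :
  Cintegrable mu D (fun x => f k (x - theta j)).
Proof.
by have [] := Cintegral_shift (- theta j) pi2 (f_2pi k) (spectral_integrable k).
Qed.

Lemma spectral_form_integrable u : Cintegrable mu D (spectral_form u).
Proof.
apply: Cintegrable_sum => // j; apply: Cintegrable_sum => // l.
exact: CintegrableZ.
Qed.

Section one_arc.
Variables (u : 'I_T -> R[i]) (delta c : R).
Hypothesis delta_small : 0 < delta <= pi / T%:R.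
Let C (j : int) : R := c - theta j.
Let ind (a : R) (x : R) : R := \1_(cos_arc delta a) x.

Let ind_measurable a : measurable_fun D (ind a).
Proof. by apply: measurable_indic; exact: measurable_cos_arc. Qed.

Let ind_Cintegrable a (g : R -> R[i]) : Cintegrable mu D g ->
  Cintegrable mu D (fun x => (ind a x)%:C * g x).
Proof.
move=> ig; apply: (@Cintegrable_mul_bounded _ _ _ mu D mD _ _ 1) => //=.
- exact: ind_measurable.
- by move=> x; exact: indic_le1.
- by move=> x; rewrite normr0.
Qed.

(** The test polynomial is the sum of the u_j times a bump centred at [C j]; evaluating at x -
    [theta k] moves the centre [C l] to [C l + theta k]. The limit is taken term by term. *)
Lemma arc_limit_form_ge0 : 0 <= \sum_(k < T) \sum_(j < T) \sum_(l < T)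
  u j * (u l)^* *
  Cintegral mu D (fun x => (ind (C j) x * ind (C l + theta k) x)%:C * f k x).
Proof.
pose p n x := \sum_(j < T) u j * (cos_bump delta (C j) n x)%:C.
pose Q n := \sum_(k < T) Cintegral mu D (fun x => p n x * (p n (x - theta k))^* * f k x).
have Q0 n : 0 <= Q n.
  apply: trigpoly_form_ge0; apply: trigpoly_sum => j.
  by apply: trigpolyM; [exact: trigpoly_cst|exact: cos_bump_trigpoly].
have QE n : Q n = \sum_(k < T) \sum_(j < T) \sum_(l < T) u j * (u l)^* *
    Cintegral mu D (fun x => (cos_bump delta (C j) n x *
                              cos_bump delta (C l + theta k) n x)%:C * f k x).
  apply: eq_bigr => k _.
  have ib (j l : 'I_T) : Cintegrable mu D (fun x => (cos_bump delta (C j) n x *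
                              cos_bump delta (C l + theta k) n x)%:C * f k x).
    by apply: arc_bump_integrable; (exact: measurable_cos_bump) || exact: cos_bump_bound.
  rewrite (_ : (fun x => _) = (fun x => \sum_(j < T) \sum_(l < T) u j * (u l)^* *
      ((cos_bump delta (C j) n x * cos_bump delta (C l + theta k) n x)%:C * f k x))).
    rewrite Cintegral_sum //; last first.
      by move=> j; apply: Cintegrable_sum => // l; exact: CintegrableZ.
    apply: eq_bigr => j _; rewrite Cintegral_sum //; last first.
      by move=> l; exact: CintegrableZ.
    by apply: eq_bigr => l _; rewrite CintegralZ.
  apply/funext => x; rewrite /p rmorph_sum !mulr_suml; apply: eq_bigr => j _.
  rewrite mulr_sumr mulr_suml; apply: eq_bigr => l _.
  rewrite rmorphM /= [RHS]mulrA; congr (_ * _).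
  rewrite mulrACA rmorphM; congr (_ * (_ * _)).
  rewrite (_ : cos_bump delta (C l + theta k) n x = cos_bump delta (C l) n (x - theta k)).
    by apply: eq_complexP; rewrite ?cReJ ?cImJ /= ?oppr0.
  by rewrite /cos_bump opprD [in LHS](addrC (- C l)) addrA.
apply: (@Ccvg_ge0 R Q _ _ Q0).
have -> : Q = _ := funext QE.
apply: Ccvg_sum => k; apply: Ccvg_sum => j; apply: Ccvg_sum => l.
apply: CcvgM; first exact: Ccvg_cst.
exact: Cintegral_bump_cvg (f_integrable k).
Qed.

Let ind_theta (a x : R) (q : int) : ind (a + theta (q * T%:Z)) x = ind a x.
Proof.
rewrite /ind !indicE; congr ((_ : bool)%:R); apply/idP/idP.
- rewrite !inE => h; have := cos_arc2pi delta a x (- q).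
  move: h; rewrite /cos_arc /theta /= intrM -pmulrn mulrA mulfK ?gt_eqF //.
  by rewrite mulrNz mulrN opprD addrA addrAC => h <-.
- rewrite !inE => h; have := cos_arc2pi delta a x (- q).
  move: h; rewrite /cos_arc /theta /= intrM -pmulrn mulrA mulfK ?gt_eqF //.
  by rewrite mulrNz mulrN opprD addrA addrAC => h ->.
Qed.

(** The centres [C j] and [C l + theta k] differ by theta (k + j - l). For fixed (j, l), only the k
    congruent to l - j modulo T survives, with coinciding arcs, and a translation by [theta j]
    carries its integral to the arc at [c]. *)
Lemma arc_form_ge0 : 0 <= Cintegral mu D (fun x => (ind c x)%:C * spectral_form u x).
Proof.
rewrite (_ : Cintegral _ _ _ = \sum_(k < T) \sum_(j < T) \sum_(l < T)
  u j * (u l)^* *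
  Cintegral mu D (fun x => (ind (C j) x * ind (C l + theta k) x)%:C * f k x)).
  exact: arc_limit_form_ge0.
have i1 (j : 'I_T) k : Cintegrable mu D (fun x => (ind c x)%:C * f k (x - theta j)).
  by apply: ind_Cintegrable; exact: shifted_term.
rewrite (_ : (fun x => _) = (fun x => \sum_(j < T) \sum_(l < T) u j * (u l)^* *
    ((ind c x)%:C * f (l%:Z - j%:Z) (x - theta j)))); last first.
  apply/funext => x; rewrite /spectral_form mulr_sumr; apply: eq_bigr => j _.
  by rewrite mulr_sumr; apply: eq_bigr => l _; rewrite mulrCA.
rewrite Cintegral_sum //; last first.
  by move=> j; apply: Cintegrable_sum => // l; exact: CintegrableZ.
rewrite [RHS]exchange_big /=; apply: eq_bigr => j _.
rewrite Cintegral_sum //; last by move=> l; exact: CintegrableZ.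
rewrite [RHS]exchange_big /=; apply: eq_bigr => l _.
rewrite CintegralZ // -mulr_sumr; congr (_ * _).
have kE := divz_eq (l%:Z - j%:Z) T.
have k0 := @modz_ge0 (l%:Z - j%:Z) T; have kT := @ltz_pmod (l%:Z - j%:Z) T.
move: kE k0 kT; set q := divz _ _; set r := modz _ _ => kE k0 kT.
have lt : (absz r < T)%N by lia.
rewrite (bigD1 (Ordinal lt)) //= [X in _ = _ + X]big1 ?addr0; last first.
  move=> k kn; rewrite (_ : (fun x => _) = (fun=> 0)) ?Cintegral0 //.
  apply/funext => x; rewrite /ind !indicE.
  have [/set_mem a1|] := boolP (x \in _); last by rewrite !mul0r.
  have [/set_mem a2|] := boolP (x \in _); last by rewrite mulr0 mul0r.
  exfalso; move/eqP: kn; apply; apply/val_inj => /=.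
  have : (T %| (k%:Z + j%:Z - l%:Z))%Z.
    (* Seen from x + [theta j], the two memberships concern the arc at [c] and its translate by
       theta (k + j - l). *)
    apply: (@cos_arc_translates_disjoint R T delta c (x + theta j)) => //.
    - by move: a1; rewrite /cos_arc /C /= opprB addrA.
    - move: a2; rewrite /cos_arc /C /theta /=; congr (is_true (_ < cos _)).
      rewrite intrB intrD; ring.
  (* k and r are congruent modulo T and both lie in [0, T[, so they are equal. *)
  move=> /dvdzP[q' q'E]; have kT' := ltn_ord k.
  have e : k%:Z - r = (q' + q) * T%:Z by rewrite mulrDl -q'E; lia.
  have z : q' + q = 0 by move: kT' k0 kT e; move: (q' + q) (nat_of_ord k) => v w; nia.
  by move: e; rewrite z mul0r; lia.
rewrite (_ : f (absz r) = f (l%:Z - j%:Z)); last first.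
  rewrite [in RHS]kE addrC spectral_periodz; congr f.
  by rewrite gez0_abs //; apply: k0; lia.
pose h x := (ind (C j) x)%:C * f (l%:Z - j%:Z) x.
have hE : (fun x => (ind (C j) x * ind (C l + theta (absz r)) x)%:C *
    f (l%:Z - j%:Z) x) = h.
  apply/funext => x; rewrite /h; congr (_%:C * _).
  have -> : C l + theta (absz r) = C j + theta ((- q) * T%:Z).
    have rE : (absz r)%:Z = l%:Z - j%:Z - q * T%:Z by lia.
    by rewrite /C /theta rE mulNr !intrB intrN; ring.
  by rewrite ind_theta /ind indicE; case: (_ \in _); rewrite ?mulr1 ?mulr0.
rewrite hE.
(* The product of indicator and density is periodic, so its integral over a period is unchanged by
   the translation. *)
have h2pi x : h (x + 2 * pi) = h x.
  rewrite /h f_2pi; congr (_%:C * _); rewrite /ind !indicE; congr ((_ : bool)%:R).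
  have := cos_arc2pi delta (C j) x 1; rewrite mulr1 => E.
  by apply/idP/idP; rewrite !inE E.
have ih : Cintegrable mu D h.
  by apply: ind_Cintegrable; exact: spectral_integrable.
have [_ <-] := Cintegral_shift (- theta j) pi2 h2pi ih.
apply: eq_Cintegral => x _; rewrite /h; congr (_%:C * _).
rewrite /ind !indicE; congr ((_ : bool)%:R).
have E : x - c = x - theta j - C j by rewrite /C; ring.
by apply/idP/idP; rewrite !inE /cos_arc /= E.
Qed.

End one_arc.
Lemma spectral_form_ae_ge0 u :
  {ae mu, forall x, x \in `[0, 2 * pi[ -> 0 <= spectral_form u x}.
Proof.
have [iR iI] := spectral_form_integrable u.
have piT : 0 < pi / T%:R :> R by rewrite divr_gt0 // pi_gt0.
have key x r : 0 < r -> r <= pi / T%:R -> 0 <= x - r -> x + r <= 2 * pi ->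
    0 <= Cintegral mu `]x - r, x + r[ (spectral_form u).
  move=> r0 rT x0 x2.
  have rT' : 0 < r <= pi / T%:R by rewrite r0.
  (* Within the period the interval is the arc of half-width r centred at x; staying inside
     [0, 2 pi] forces r <= pi. *)
  have -> : `]x - r, x + r[%classic = D `&` cos_arc r x.
    have rpi : 0 < r <= pi by lra.
    apply/seteqP; split => y /=.
      move=> yI; have yD : y \in `[0, 2 * pi[.
        by move: yI; rewrite !in_itv /= => /andP[? ?]; apply/andP; split; lra.
      by split => //; apply/(cos_arc_itv rpi x0 x2 yD).
    by move=> [yD ya]; apply/(cos_arc_itv rpi x0 x2 yD).
  have := arc_form_ge0 u x rT'; congr (0 <= _); apply: eq_complexP => /=.
  - rewrite Rintegral_mkcondr; apply: eq_Rintegral => y _.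
    rewrite patchE indicE cReM /=.
    by case: (_ \in _); rewrite ?mul1r !mul0r subr0.
  - rewrite Rintegral_mkcondr; apply: eq_Rintegral => y _.
    rewrite patchE indicE cImM /=.
    by case: (_ \in _); rewrite ?mul1r !mul0r addr0.
have aeR := @ae_ge0_of_small_intervals R _ _ (fun x => complex.Re (spectral_form u x)) piT iR
  (fun x r r0 rT x0 x2 => ltac:(by have := key x r r0 rT x0 x2; rewrite complex_ge0 => /andP[])).
have aeI := @ae_ge0_of_small_intervals R _ _ (fun x => complex.Im (spectral_form u x)) piT iI
  (fun x r r0 rT x0 x2 => ltac:(by have := key x r r0 rT x0 x2; rewrite complex_ge0 => /andP[/eqP /= -> _])).
(* The integrals of the imaginary part over short intervals vanish, so the differentiation lemma
   applies to it with both signs and makes it null almost everywhere. *)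
have aeN : {ae mu, forall x, x \in `[0, 2 * pi[ -> 0 <= - complex.Im (spectral_form u x)}.
  apply: (@ae_ge0_of_small_intervals R _ _ (fun x => - complex.Im (spectral_form u x) : R) piT).
    by have := integrableN iI.
  move=> x r r0 rT x0 x2.
  have iI' : mu.-integrable `]x - r, x + r[ (EFin \o (fun y => complex.Im (spectral_form u y))).
    have sub : `]x - r, x + r[ `<=` D.
      by move=> y; rewrite /D /= !in_itv /= => /andP[? ?]; apply/andP; split; lra.
    by apply: integrableS iI => //; exact: sub.
  have := key x r r0 rT x0 x2; rewrite complex_ge0 => /andP[/eqP /= h _].
  have E : \int[mu]_(y in `]x - r, x + r[) (-1 * complex.Im (spectral_form u y)) = 0.
    by rewrite RintegralZl // h mulr0.
  rewrite (_ : \int[mu]_(y in _) _ = 0) // -[RHS]E.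
  by apply: eq_Rintegral => y _; rewrite mulN1r.
move: aeR aeI aeN; apply: filterS3; first exact: (ae_filter_ringOfSetsType mu).
move=> x aR aI aN xD; rewrite complex_ge0 aR // andbT eq_le aI // andbT.
by rewrite -oppr_ge0 aN.
Qed.

End positive_spectral_form.

(** * Nonnegative complex forms are Hermitian *)

Section nonneg_forms.
Local Open Scope ring_scope.
Local Open Scope sesquilinear_scope.
Context {C : numClosedFieldType} (n : nat).
Implicit Types (A : 'M[C]_n) (u v : 'rV[C]_n).

Lemma quadratic_formE A u : (u *m A *m u ^t*) 0 0 =
  \sum_(j < n) \sum_(l < n) u 0 j * (u 0 l)^* * A j l.
Proof.
rewrite mxE exchange_big /=; apply: eq_bigr => l _.
rewrite !mxE mulr_suml; apply: eq_bigr => j _.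
by rewrite mulrAC.
Qed.

(** Polarization: the form is real at e_i + e_j and at e_i + 'i e_j. With p = A_ij and q = A_ji this
    gives [e1] and [e2], whose sum is 2 (conj p - q) = 0. *)
Lemma nonneg_definite_hermitian A : nonneg_definite A -> A \is hermsymmx.
Proof.
move=> A0; apply/is_hermitianmxP; rewrite expr0 scale1r.
pose B u v := (u *m A *m v ^t*) 0 0.
have Bj u : (B u u)^* = B u u by apply/CrealP; exact: ger0_real (A0 u).
have BDl u v w : B (u + v) w = B u w + B v w by rewrite /B !mulmxDl mxE.
have BDr u v w : B u (v + w) = B u v + B u w.
  by rewrite /B linearD /= map_mxD mulmxDr mxE.
have BZl a u w : B (a *: u) w = a * B u w by rewrite /B -!scalemxAl mxE.
have BZr a u w : B u (a *: w) = a^* * B u w.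
  by rewrite /B linearZ /= map_mxZ -scalemxAr mxE.
have BE i j : B (delta_mx 0 i) (delta_mx 0 j) = A i j.
  rewrite /B (_ : (delta_mx 0 j) ^t* = delta_mx j 0); last first.
    by apply/matrixP => a b; rewrite !mxE andbC; case: (_ && _); rewrite ?conjC1 ?conjC0.
  by rewrite -rowE -colE !mxE.
apply/matrixP => i j; rewrite !mxE.
pose x : 'rV[C]_n := delta_mx 0 i; pose y : 'rV[C]_n := delta_mx 0 j.
have h1 := Bj (x + y); have h2 := Bj (x + 'i *: y).
have hx := Bj x; have hy := Bj y.
move: h1 h2; rewrite !(BDl, BDr, BZl, BZr) !BE !(rmorphD, rmorphM) /=.
move: hx hy; rewrite !BE => -> ->; rewrite !conjCK !conjCi.
move: (A i i) (A i j) (A j i) (A j j) => a p q b.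
move: (p^*) (q^*) => p' q' h1 h2.
have e1 : p' + q' - (p + q) = 0.
  by rewrite -(subrr (a + p + (q + b))) -{1}h1; ring.
have e2 : p' - q' + p - q = 0.
  apply: (mulfI (neq0Ci C)); rewrite mulr0.
  by rewrite -(subrr (a + - 'i * p + ('i * q + 'i * (- 'i * b)))) -{1}h2; ring.
have two0 : (2 : C) != 0 by rewrite pnatr_eq0.
apply: (mulfI two0); apply/eqP; rewrite -subr_eq0; apply/eqP.
by rewrite -[RHS](subrr 0) -{1}e2 -e1; ring.
Qed.

End nonneg_forms.

(** * From Gaussian integer vectors to all complex vectors *)

Section gaussian_integers.
Context {R : realType}.

Lemma floor_cvg (x : R) :
  (Num.floor (n.+1%:R * x))%:~R / n.+1%:R @[n --> \oo] --> x.
Proof.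
apply: (@squeeze_cvgr _ _ _ _ (fun n => x - n.+1%:R^-1) (cst x)).
- apply: nearW => n /=; have n0 : 0 < n.+1%:R :> R by [].
  have h1 : (Num.floor (n.+1%:R * x))%:~R <= n.+1%:R * x by exact: floor_le.
  have h2 : n.+1%:R * x < (Num.floor (n.+1%:R * x) + 1)%:~R by exact: floorD1_gt.
  rewrite ler_pdivlMr // ler_pdivrMr // mulrBl mulVf ?gt_eqF //.
  by move: h2; rewrite intrD; lra.
- rewrite -[X in _ --> X]subr0; apply: cvgB; first exact: cvg_cst.
  exact: cvg_harmonic.
- exact: cvg_cst.
Qed.

(** Vectors are indexed by pairs of finite functions into [int], a countable type as [ae_countable]
    requires. *)
Definition gaussian (T : nat) (ab : {ffun 'I_T -> int} * {ffun 'I_T -> int})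
  (j : 'I_T) : R[i] := (ab.1 j)%:~R +i* (ab.2 j)%:~R.

Lemma nonneg_definite_gaussian (T : nat) (A : 'M[R[i]]_T) :
  (forall ab, 0 <= \sum_(j < T) \sum_(l < T)
     gaussian ab j * (gaussian ab l)^* * A j l) -> nonneg_definite A.
Proof.
move=> A0 u; rewrite quadratic_formE.
have conjR (r : R) : (r%:C)^*%R = r%:C.
  by apply: eq_complexP; rewrite ?cReJ ?cImJ /= ?oppr0.
pose ab n : {ffun 'I_T -> int} * {ffun 'I_T -> int} :=
  ([ffun j => Num.floor (n.+1%:R * complex.Re (u 0 j))],
   [ffun j => Num.floor (n.+1%:R * complex.Im (u 0 j))]).
(* Rounding (n + 1) u and dividing by n + 1 approximates u; the real scaling factor leaves the form
   as its square. *)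
pose v n j : R[i] := (n.+1%:R^-1 : R)%:C * gaussian (ab n) j.
have vu j : Ccvg (v ^~ j) (u 0 j).
  split.
  - rewrite (_ : (fun n => _) =
      (fun n => (Num.floor (n.+1%:R * complex.Re (u 0 j)))%:~R / n.+1%:R)).
      exact: floor_cvg.
    by apply/funext => n; rewrite /v cReM /= ffunE mul0r subr0 mulrC.
  - rewrite (_ : (fun n => _) =
      (fun n => (Num.floor (n.+1%:R * complex.Im (u 0 j)))%:~R / n.+1%:R)).
      exact: floor_cvg.
    by apply/funext => n; rewrite /v cImM /= ffunE mul0r addr0 mulrC.
apply: (@Ccvg_ge0 R (fun n => \sum_(j < T) \sum_(l < T) v n j * (v n l)^* * A j l)).
  apply: Ccvg_sum => j; apply: Ccvg_sum => l; apply: CcvgM; last exact: Ccvg_cst.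
  by apply: CcvgM => //; exact: Ccvg_conj.
move=> n; rewrite (_ : \sum_(j < T) _ = (n.+1%:R^-1 ^+ 2 : R)%:C *
    \sum_(j < T) \sum_(l < T) gaussian (ab n) j * (gaussian (ab n) l)^* * A j l).
  by apply: mulr_ge0 => //; rewrite ler0c sqr_ge0.
rewrite mulr_sumr; apply: eq_bigr => j _; rewrite mulr_sumr; apply: eq_bigr => l _.
rewrite /v rmorphM /= [RHS]mulrA; congr (_ * _).
by rewrite conjR mulrACA rmorphXn expr2.
Qed.

End gaussian_integers.

(** Countable intersection along [pickle]; numbers that decode to nothing get the trivial
    property. *)
Lemma ae_countable d (U : measurableType d) (R : realType)
    (mu : {measure set U -> \bar R}) (V : countType) (P : V -> U -> Prop) :
  (forall v, {ae mu, forall x, P v x}) -> {ae mu, forall x, forall v, P v x}.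
Proof.
move=> aeP.
pose P' n x := if unpickle n is Some v then P v x else True.
have : {ae mu, forall x, forall n, P' n x}.
  apply/ae_foralln => n; rewrite /P'; case: (unpickle n) => [v|]; first exact: aeP.
  exact: aeW.
apply: filterS => x h v; have := h (pickle v).
by rewrite /P' pickleK.
Qed.

Theorem proposition2p2 (d : measure_display) (Om : measurableType d)
    (R : realType) (P : probability Om R) (H alpha : R) (T : nat)
    (X : R -> {RV P >-> R}) (f : int -> R -> R[i]) :
  0 < H -> 1 < alpha -> (0 < T)%N ->
  DTSI alpha H T X ->
  let Y := PC_counterpart alpha H X in
  spectral_densities T Y f ->
  [/\ DTPC T Y,
      forall n tau : nat,
        (Cov (X (alpha ^+ n)) (X (alpha ^+ (n + tau))))%:C =
        (alpha `^ ((2 * n + tau)%:R * H))%:C *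
        \sum_(k < T) PCcoef T Y k tau * expi (2 * k%:R * pi * n%:R / T%:R),
      forall (k : 'I_T) (tau : nat),
        PCcoef T Y k tau =
        Cintegral (@lebesgue_measure R) `[0, 2 * pi[
          (fun w => expi (tau%:R * w) * f k w),
      forall (j k : 'I_T) (w : R), w \in `[0, 2 * pi[ ->
        spectral_density_matrix T f w j k =
        T%:R^-1 * f (k%:Z - j%:Z) ((w - 2 * pi * j%:R) / T%:R) &
      {ae @lebesgue_measure R, forall w, w \in `[0, 2 * pi[ ->
        spectral_density_matrix T f w \is hermsymmx /\
        nonneg_definite (spectral_density_matrix T f w)} ].
Proof.
move=> H0 alpha1 T0 XSI Y [[F Fm Fd] [fT f2pi]].
have alpha0 : 0 < alpha by exact: lt_trans alpha1.
have YPC := DTSI_DTPC alpha0 XSI.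
have fint (k : 'I_T) : Cintegrable (@lebesgue_measure R) `[0, 2 * pi[ (f k).
  exact: (Fd k).1.
have coefE (k : 'I_T) (tau : int) : PCcoef T Y k tau =
    Cintegral (@lebesgue_measure R) `[0, 2 * pi[
      (fun w => expi (tau%:~R * w) * f k w).
  have [mr mi] := @measurable_expi R tau%:~R `[0, 2 * pi[%classic.
  rewrite Fm; apply: (@cm_integral_density _ _ _ _ (F k) _ (f k) _ 1) => //.
  - by move=> x; exact: cos_max.
  - by move=> x; exact: sin_max.
split=> //.
- move=> n tau; rewrite (Cov_DTSI_counterpart alpha0 XSI) rmorphM /=.
  rewrite addnA addnn -mul2n; congr (_ * _).
  by rewrite -(PCcov_nat T0 YPC) (PCcoef_inversion T0 YPC).
- by move=> j k w _; rewrite mxE.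
(* What remains is positivity; the spectral form is fed with the covariances at integer times. *)
pose rho (n tau : int) := (PCcov T Y n tau)%:C.
have rhoE n tau : rho n tau = \sum_(k < T) Cintegral (@lebesgue_measure R)
    `[0, 2 * pi[ (fun w => expi (tau%:~R * w) * f k w) *
    expi (2 * k%:R * pi * n%:~R / T%:R).
  rewrite /rho (PCcoef_inversion T0 YPC); apply: eq_bigr => k _.
  by rewrite coefE.
have rho_nonneg (s : seq (R[i] * int)) :
    0 <= \sum_(a <- s) \sum_(b <- s) a.1 * (b.1)^* * rho b.2 (a.2 - b.2).
  exact: (PCcov_nonneg T0 YPC).
have TR : 0 < T%:R^-1 :> R by rewrite invr_gt0 ltr0n.
have := ae_countable (fun ab => ae_scale TR
  (spectral_form_ae_ge0 T0 fint fT f2pi rhoE rho_nonneg (gaussian ab))).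
apply: filterS.
move=> w h wD.
suff nn : nonneg_definite (spectral_density_matrix T f w).
  by split => //; exact: nonneg_definite_hermitian.
apply: nonneg_definite_gaussian => ab.
have T1 : 1 <= T%:R :> R by rewrite ler1n.
(* The form is known to be nonnegative on one period only; w/T stays there because T >= 1. *)
have wT : T%:R^-1 * w \in `[0, 2 * pi[.
  move: wD; rewrite !in_itv /= => /andP[w0 w2].
  rewrite mulr_ge0 ?(ltW TR) //=; apply: le_lt_trans w2.
  by rewrite ler_piMl // invf_le1 // ltr0n.
(* The positive factor 1/T turns the form at w/T into the quadratic form of the matrix at w. *)
have := h ab wT; rewrite -(pmulr_rge0 _ (_ : 0 < (T%:R^-1 : R)%:C)) ?ltcR //.
rewrite /spectral_form /theta; congr (_ <= _); rewrite mulr_sumr; apply: eq_bigr => j _.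
rewrite mulr_sumr; apply: eq_bigr => l _.
rewrite mxE mulrCA; congr (_ * (_ * f _ _)); first by rewrite fmorphV rmorph_nat.
by rewrite mulrC mulrBl.
Qed.
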